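(* Let $N\ge3$ be odd, let $\bar V$ be the symplectic $F$-vector space with circular basis $\{\bar e_s; s\in S\}$, $|S|=N$, described in the context, and let $B\in R$. Then $B\in\phi(\bar V)$ if and only if $L_B\in\mathcal{F}(\bar V)$.
   Context: $F=\mathbb{Z}/2$; $N\ge3$ is odd. $(S,\mathfrak{E})$ is a graph which is a cycle with $N$ vertices. $V$ is an $F$-vector space with basis $\{e_s;s\in S\}$ and symplectic (alternating bilinear) form with, for $s\ne s'$, $\langle e_s,e_{s'}\rangle=1$ if $\{s,s'\}\in\mathfrak{E}$ and $0$ otherwise. $\bar V=V/F e_S$, $e_S=\sum_{s\in S}e_s$, with induced (nondegenerate) form; $\bar e_s$ is the image of $e_s$; $\bar e_I=\sum_{s\in I}\bar e_s$ for $I\subset S$. The family $\{\bar e_s\}_{s\in S}$ is called a circular basis of $\bar V$. For $I\subset S$, $\underline I$ is the full subgraph on $I$. $\mathcal{I}$ is the set of $I\subset S$ with $\underline I$ a path with $m\ge1$ vertices; $\mathcal{I}^1=\{I\in\mathcal{I};|I|\text{ odd}\}$. For $I,I'\in\mathcal{I}^1$: $I\prec I'$ means $I\subsetneq I'$ and $\underline{I'-I}$ is disconnected; $I\spadesuit I'$ means $I\cap I'=\emptyset$ and $\underline{I\cup I'}$ is disconnected. For $I\in\mathcal{I}^1$, $I^{ev}$ is the set of $s\in I$ with $I-\{s\}=I'\sqcup I''$, $I',I''\in\mathcal{I}^1$, $I'\spadesuit I''$. $R$ is the set of finite subsets of $\mathcal{I}^1$; for $B\in R$, $L_B\subset\bar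 V$ is the subspace spanned by $\{\bar e_I;I\in B\}$. $\phi(\bar V)$ is the set of $B\in R$ such that: $(P_0)$ if $I,I'\in B$ then $I=I'$ or $I\spadesuit I'$ or $I\prec I'$ or $I'\prec I$; $(P_1)$ for each $I\in B$ there are pairwise disjoint $I_1,\dots,I_k\in B$ ($k\ge0$) with all $I_j\prec I$ and $I^{ev}\subset I_1\cup\dots\cup I_k$. Inductive definition of $\mathcal{F}(\bar V)$ (a collection of subspaces of $\bar V$). For $s\in S$ let $\hat s=\{s\}\cup\{s'\in S;\langle\bar e_s,\bar e_{s'}\rangle=1\}$ (three elements), $\bar e_s^\perp=\{x\in\bar V;\langle x,\bar e_s\rangle=0\}$, $\bar V_s=\bar e_s^\perp/F\bar e_s$, and $\bar p_s:\bar e_s^\perp\to\bar V_s$ the quotient map. If $N=3$, $\mathcal{F}(\bar V)$ consists of $0$ and of $\bar p_s^{-1}(0)=F\bar e_s$, $s\in S$. If $N\ge5$, $\bar V_s$ is a symplectic space with circular basis consisting of the images of $\bar e_{s'}$ ($s'\in S-\hat s$) and of $\bar e_{\hat s}$, indexed by $S_s=(S-\hat s)\sqcup\{\hat s\}$ (with $N-2$ elements), so $\mathcal{F}(\bar V_s)$ is defined by induction; $\mathcal{F}(\bar V)$ consists of $0$ and of all $\bar p_s^{-1}(L')$ with $s\in S$, $L'\in\mathcal{F}(\bar V_s)$. *)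

(* Defs.v *)
From HB Require Import structures.
From mathcomp Require Import all_boot all_algebra.

Set Implicit Arguments.
Unset Strict Implicit.
Unset Printing Implicit Defensive.

Import GRing.Theory.
Local Open Scope ring_scope.

Section CycleGraph.
Variables (S : finType) (adj : rel S).

Definition cycle_graph : Prop :=
  exists c : seq S,
    [/\ (3 <= size c)%N, uniq c, (forall s, s \in c)
      & forall s t, adj s t = (t == next c s) || (s == next c t)].

(* The tuple p lists the vertices of I in their order along the path. *)
Definition is_path (I : {set S}) : bool :=
  (I != set0) && [exists p : #|I|.-tuple S,
    [&& uniq p, I == [set s in p]
      & [forall s in I, forall t in I, adj s t ==
          (index t p == (index s p).+1) || (index s p == (index t p).+1)]]].

Definition induced (J : {set S}) : rel S :=
  [rel s t | [&& s \in J, t \in J & adj s t]].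

Definition disconnected (J : {set S}) : bool :=
  [exists s in J, exists t in J, ~~ connect (induced J) s t].

Definition I1 : {set {set S}} := [set I | is_path I & odd #|I|].

Definition prec (I I' : {set S}) : bool :=
  (I \proper I') && disconnected (I' :\: I).

Definition spade (I I' : {set S}) : bool :=
  (I :&: I' == set0) && disconnected (I :|: I').

Definition ev (I : {set S}) : {set S} :=
  [set s in I | [exists I' in I1, exists I'' in I1,
    (I :\ s == I' :|: I'') && spade I' I'']].

Definition P0 (B : {set {set S}}) : bool :=
  [forall I in B, forall I' in B,
    [|| I == I', spade I I', prec I I' | prec I' I]].

(* The pairwise disjoint I_1, ..., I_k are the members of C; members of I1 are
   nonempty, so a pairwise disjoint family in B has no repetitions. *)
Definition P1 (B : {set {set S}}) : bool :=
  [forall I in B, exists C : {set {set S}},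
    [&& C \subset B, trivIset C, [forall J in C, prec J I]
      & ev I \subset cover C]].

Definition phi : {set {set {set S}}} :=
  [set B : {set {set S}} | [&& B \subset I1, P0 B & P1 B]].

End CycleGraph.

(* The quotient of vT by U, realized on a fixed complement of U; quotv_pi is the
   projection vT -> vT / U and quotv_repr picks representatives. *)
Section Quotient.
Variables (K : fieldType) (vT : vectType K) (U : {vspace vT}).

Definition quotv : vectType K := subvs_of (U^C)%VS.

Definition quotv_pi : 'Hom(vT, quotv) :=
  (linfun (@vsproj _ _ (U^C)%VS) \o daddv_pi (U^C)%VS U)%VF.

Definition quotv_repr : 'Hom(quotv, vT) := linfun (@vsval _ _ (U^C)%VS).

Lemma quotv_reprK : cancel quotv_repr quotv_pi.
Proof.
have cap0 : (U^C :&: U = 0)%VS by rewrite capvC capv_compl.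
move=> x; rewrite /quotv_pi /quotv_repr comp_lfunE !lfunE /=.
by rewrite daddv_pi_id ?subvsP // vsvalK.
Qed.

Lemma limg_quotv_pi : limg quotv_pi = fullv.
Proof.
apply/vspaceP=> x; rewrite memvf -[x]quotv_reprK.
by rewrite memv_img ?memvf.
Qed.

Lemma quotv_piK v : v - quotv_repr (quotv_pi v) \in U.
Proof.
have cap0 : (U^C :&: U = 0)%VS by rewrite capvC capv_compl.
rewrite /quotv_pi /quotv_repr comp_lfunE !lfunE /= vsprojK ?memv_pi //.
rewrite -{1}(@daddv_pi_add _ _ _ _ v cap0); last first.
  by rewrite addvC addv_complf memvf.
by rewrite addrC addKr memv_pi.
Qed.

Lemma lker_quotv_pi : lker quotv_pi = U.
Proof.
have cap0 : (U^C :&: U = 0)%VS by rewrite capvC capv_compl.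
apply/vspaceP=> v; rewrite memv_ker; apply/eqP/idP=> [v0|vU].
  by have := quotv_piK v; rewrite v0 linear0 subr0.
rewrite /quotv_pi comp_lfunE.
suff -> : daddv_pi (U^C)%VS U v = 0 by rewrite linear0.
have cap0' := capv_compl U.
have := @daddv_pi_add _ _ _ _ v cap0.
rewrite addvC addv_complf memvf => /(_ isT).
by rewrite (daddv_pi_id cap0') // -[X in _ = X]add0r => /addIr.
Qed.

End Quotient.

Section Pullback.
Variables (K : fieldType) (U V : vectType K).

Definition pullback (f : {biscalar V}) (g : 'Hom(U, V)) (x y : U) : K :=
  f (g x) (g y).

Variables (f : {biscalar V}) (g : 'Hom(U, V)).

Lemma pullback_is_bilinear : bilinear_for *%R *%R (pullback f g).
Proof.
by split=> x a y z; rewrite /pullback linearP ?linearPl ?linearPr.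
Qed.

HB.instance Definition _ :=
  bilinear_isBilinear.Build K U U K *%R *%R (pullback f g) pullback_is_bilinear.

End Pullback.

Section FormConstructions.
Variables (K : fieldType) (V : vectType K) (f : {biscalar V}).

(* f^~ v is used as a linear map to the regular module K^o. *)
Definition orthv (v : V) : {vspace V} := lker (linfun (f^~ v : V -> K^o)).

Lemma mem_orthv v x : (x \in orthv v) = (f x v == 0).
Proof.
have lin : linear (f^~ v : V -> K^o) by move=> a y z; rewrite linearPl.
pose g := GRing.isLinear.Build K V K^o *:%R (f^~ v : V -> K^o) lin.
pose h : {linear V -> K^o} := HB.pack (f^~ v : V -> K^o) g.
by rewrite memv_ker -[X in linfun X]/(h : V -> K^o) lfunE.
Qed.

Definition sub_form (W : {vspace V}) : {biscalar (subvs_of W)} :=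
  pullback f (linfun (@vsval _ _ W)).

Lemma sub_formE (W : {vspace V}) (x y : subvs_of W) :
  sub_form W x y = f (vsval x) (vsval y).
Proof. by rewrite /= /pullback !lfunE. Qed.

Definition quot_form (U : {vspace V}) : {biscalar (quotv U)} :=
  pullback f (quotv_repr U).

(* When U lies in the radical of f, quot_form f U is the induced form. *)
Lemma quot_formE (U : {vspace V}) x y :
    (forall u z, u \in U -> f u z = 0) -> (forall u z, u \in U -> f z u = 0) ->
  quot_form U (quotv_pi U x) (quotv_pi U y) = f x y.
Proof.
move=> radl radr; rewrite /= /pullback; apply/esym/eqP; rewrite -subr_eq0.
set x' := quotv_repr U _; set y' := quotv_repr U _.
have -> : f x y - f x' y' = f (x - x') y + f x' (y - y').
  by rewrite linearBl linearBr addrA subrK.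
by rewrite radl ?radr ?addr0 ?quotv_piK.
Qed.

End FormConstructions.

(* A form together with a family of vectors indexed by a finite set. When the
   family is a circular basis the cycle on the index set is determined by the
   form: s and t (s != t) are joined iff <e_s, e_t> = 1. *)
Record form_family := FormFamily {
  fspace : vectType 'F_2;
  fform : {biscalar fspace};
  findex : finType;
  fvec : findex -> fspace }.

Section Reduction.
Variables (X : form_family) (s : findex X).
Local Notation e := (@fvec X).

Definition hat : {set findex X} := s |: [set t | fform X (e s) (e t) == 1].

Definition perp : {vspace fspace X} := orthv (fform X) (e s).

Definition perp_line : {vspace subvs_of perp} := <[vsproj perp (e s)]>%VS.

Definition red_space : vectType 'F_2 := quotv perp_line.

Definition red_pi : 'Hom(subvs_of perp, red_space) := quotv_pi perp_line.

Definition red_form : {biscalar red_space} :=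
  quot_form (sub_form (fform X) perp) perp_line.

(* The index set (S - hat s) + {hat s}; None stands for the element hat s. *)
Definition red_index : finType := option {t : findex X | t \notin hat}.

(* The vectors below lie in perp when X is a circular basis, so that vsproj
   merely regards them as elements of the subspace. *)
Definition red_vec (i : red_index) : red_space :=
  red_pi (vsproj perp
    (if i is Some t then e (val t) else \sum_(t in hat) e t)).

Definition reduction : form_family := FormFamily red_form red_vec.

Definition red_preim (L : {vspace red_space}) : {vspace fspace X} :=
  (linfun (@vsval _ _ perp) @: (red_pi @^-1: L))%VS.

End Reduction.

Inductive Fcal (X : form_family) : {vspace fspace X} -> Prop :=
| Fcal0 : Fcal 0%VS
| Fcal3 (s : findex X) : #|findex X| = 3%N -> Fcal (red_preim (s := s) 0%VS)
| Fcal5 (s : findex X) (L : {vspace fspace (reduction s)}) :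
    (5 <= #|findex X|)%N -> Fcal L -> Fcal (red_preim L).

Arguments Fcal X L : clear implicits.

Section Vbar.
Variables (S : finType) (V : vectType 'F_2) (form : {biscalar V}) (e : S -> V).

Definition eS_line : {vspace V} := <[\sum_(s : S) e s]>%VS.

Definition Vbar_space : vectType 'F_2 := quotv eS_line.

Definition ebar (s : S) : Vbar_space := quotv_pi eS_line (e s).

Definition Vbar : form_family := FormFamily (quot_form form eS_line) ebar.

Definition ebar_set (I : {set S}) : Vbar_space := \sum_(s in I) ebar s.

Definition LB (B : {set {set S}}) : {vspace Vbar_space} :=
  <<[seq ebar_set J | J in B]>>%VS.

End Vbar.

(* Main.v *)
Require Import Defs.
From mathcomp Require Import all_boot all_algebra zify.

Set Implicit Arguments.
Unset Strict Implicit.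
Unset Printing Implicit Defensive.

Import GRing.Theory.
Local Open Scope ring_scope.

(** The cyclic order is carried by a successor map [sg], and the shape of a vertex set U
    is read off its set of right ends, the t in U with [sg t] outside U: U is a path iff it
    has one right end, disconnected iff it has at least two, and membership in [ev I]
    alternates along an arc I.  Right ends are preserved by contracting hat s to a
    vertex, so B' lies in phi of the contracted cycle iff the family made of {s} and of
    the preimages of the members of B' lies in phi; on the linear side the span of this
    family is the preimage of the span of B'.  A nonempty B in phi always contains a
    singleton {s} (a minimal member has no even vertices) and then arises from some B'
    in this way.  By induction on N, phi and F correspond under B |-> L_B.  The same
    induction gives dim L_B = |B| and shows that every odd arc I with e_I in L_B belongs
    to B; hence a family C of odd arcs with L_C = L_B is contained in B and has at
    least |B| members, so C = B. *)

(** * Arcs of a cyclic successor *)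

Section CyclicSuccessor.
Local Open Scope nat_scope.
Variables (S : finType) (sg : S -> S).

(** That [sg] is a single cycle is stated through invariant subsets: in this form it serves directly
    to propagate a property around the cycle, and it passes to the contracted cycle by taking
    preimages. *)
Definition cyclic_succ : Prop :=
  [/\ injective sg, 3 <= #|S| &
      forall U : {set S}, (forall t, t \in U -> sg t \in U) -> U = set0 \/ U = setT].

(* Right ends of the maximal runs of U: for U <> S they count its components. *)
Definition rend (U : {set S}) : {set S} := [set t in U | sg t \notin U].

Lemma rendP (U : {set S}) t : reflect (t \in U /\ sg t \notin U) (t \in rend U).
Proof. by rewrite inE; apply: andP. Qed.

Hypothesis sgC : cyclic_succ.

Lemma sg_inj : injective sg. Proof. by case: sgC. Qed.

Lemma card_ge3 : 3 <= #|S|. Proof. by case: sgC. Qed.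

Lemma sg_closed (U : {set S}) :
  {in U, forall t, sg t \in U} -> U = set0 \/ U = setT.
Proof. by case: sgC => _ _; apply. Qed.

Lemma sg_closedT (U : {set S}) x :
  {in U, forall t, sg t \in U} -> x \in U -> U = setT.
Proof. by case/sg_closed=> [->|//]; rewrite inE. Qed.

Lemma sg_onto t : exists a, t = sg a.
Proof. by exists (finv sg t); rewrite (f_finv sg_inj). Qed.

(** If the k-th iterate returned to a, the k iterates listed so far would form an invariant set,
    hence all of S, with fewer than [#|S|] elements. *)
Lemma iter_sg_neq k a : 0 < k < #|S| -> iter k sg a != a.
Proof.
case: k => // k /= ltk; apply/eqP => Ek.
have cl : {in [set x in traject sg a k.+1], forall t, sg t \in [set x in traject sg a k.+1]}.
  move=> t; rewrite !in_set => /trajectP[i lti ->]; rewrite -iterS.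
  have [Ei|ni] := eqVneq i k; first by rewrite Ei iterS Ek mem_head.
  by apply/trajectP; exists i.+1 => //; lia.
have /(congr1 (fun U : {set S} => #|U|)) := sg_closedT (x := a) cl (ltac:(by rewrite in_set mem_head)).
rewrite cardsT cardsE => E; have := card_size (traject sg a k.+1).
by rewrite E size_traject leqNgt ltk.
Qed.

Lemma sg_neq a : sg a != a.
Proof. by apply: (@iter_sg_neq 1); exact: ltnW card_ge3. Qed.

Lemma sg2_neq a : sg (sg a) != a.
Proof. by apply: (@iter_sg_neq 2); exact: card_ge3. Qed.

Lemma rend0 (U : {set S}) : rend U = set0 -> U = set0 \/ U = setT.
Proof.
move=> r0; apply: sg_closed => t tU; apply: contraT => nt.
by have := in_set0 t; rewrite -r0 inE tU nt.
Qed.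

(** Induction on the size of U, removing the right end z. If the predecessor w of z lies in U, it is
    the only right end of [U :\ z]; otherwise [U :\ z] is invariant and misses z, so it is empty. *)
Lemma rend1_arc (U : {set S}) z : rend U = [set z] ->
  exists x m, [/\ iter m sg x = z, #|U| = m.+1 & U =i traject sg x m.+1].
Proof.
have [n] := ubnP #|U|; elim: n U z => // n IH U z /ltnSE leUn rU.
have zP t : (t \in U) && (sg t \notin U) = (t == z) by rewrite -[RHS]in_set1 -rU inE.
have /andP[zU szU] : (z \in U) && (sg z \notin U) by rewrite zP.
have nT : U != setT by apply: contraNneq szU => ->; rewrite inE.
have [w Ez] := sg_onto z.
have [wU|wU] := boolP (w \in U).
  have wz : w != z by rewrite Ez eq_sym sg_neq.
  have rU' : rend (U :\ z) = [set w].
    apply/setP=> t; rewrite !inE negb_and negbK {2}Ez (inj_eq sg_inj).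
    have := zP t; case: (eqVneq t w) => [->|_ /=]; first by rewrite wz wU.
    by case: (eqVneq t z).
  have cU : #|U| = #|U :\ z|.+1 by rewrite (cardsD1 z) zU.
  have [|x [m [Ew cm Um]]] := IH _ w _ rU'; first by rewrite -ltnS -cU.
  exists x, m.+1; split; [by rewrite iterS Ew | by rewrite cU cm |].
  move=> t; rewrite trajectSr mem_rcons inE -Um !inE iterS Ew -Ez.
  by case: (eqVneq t z) => // ->.
have U1 : U = [set z].
  apply/eqP; rewrite eqEsubset sub1set zU andbT -setD_eq0; apply/eqP.
  have cl : {in U :\ z, forall t, sg t \in U :\ z}.
    move=> t; rewrite !inE => /andP[tz tU]; have := zP t.
    rewrite tU (negPf tz) /= => /negbFE->; rewrite andbT.
    by apply: contraNneq wU => /eqP; rewrite Ez (inj_eq sg_inj) => /eqP <-.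
  have [//|E] := sg_closed cl.
  by have := in_setT z; rewrite -E !inE eqxx.
exists z, 0; split=> //; first by rewrite U1 cards1.
by move=> t; rewrite U1 !inE.
Qed.

(* An arc with its position function: [k] sends the [i]-th vertex to [i]. *)
Lemma rend1_index (U : {set S}) z : rend U = [set z] ->
  exists x (k : S -> nat),
    [/\ #|U| = (k z).+1, forall t, (t \in U) = (k t <= k z),
        {in U, forall t, t = iter (k t) sg x} &
        forall i, i <= k z -> k (iter i sg x) = i].
Proof.
move=> rU; have [x [m [Ez cm Um]]] := rend1_arc rU.
have un : uniq (traject sg x m.+1).
  by apply/card_uniqP; rewrite size_traject -[RHS]cm; apply: eq_card => t; rewrite Um.
pose k t := index t (traject sg x m.+1).
have ki i : i <= m -> k (iter i sg x) = i.
  by move=> im; rewrite /k -(nth_traject sg (im : i < m.+1) x) index_uniq ?size_traject.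
have kz : k z = m by rewrite -Ez ki.
exists x, k; rewrite kz; split=> // [t|t].
  by rewrite Um -index_mem size_traject ltnS.
rewrite Um => tU; have := tU; rewrite -index_mem size_traject => lt.
by rewrite -(nth_traject sg lt x) nth_index.
Qed.

(** * Connectedness and paths in terms of right ends *)

Variable adj : rel S.
Hypothesis adjE : forall s t, adj s t = (t == sg s) || (s == sg t).

Lemma arc_connect (U : {set S}) x m :
  (forall i, i <= m -> iter i sg x \in U) ->
  forall i, i <= m -> connect (induced adj U) x (iter i sg x).
Proof.
move=> inU; elim=> [|i IH] im; first exact: connect0.
apply: connect_trans (IH (ltnW im)) (connect1 _).
by apply/and3P; split; rewrite ?adjE ?eqxx //; [apply: inU; apply: ltnW | apply: (inU i.+1)].
Qed.

Lemma induced_sym (U : {set S}) : symmetric (induced adj U).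
Proof. by move=> s t; rewrite /induced /= !adjE orbC andbCA. Qed.

(** Two right ends belong to runs that no edge inside U joins. With one right end U is an arc,
    connected vertex by vertex from its start; with none it is empty or the whole cycle. *)
Lemma disconnectedE (U : {set S}) : disconnected adj U = (1 < #|rend U|).
Proof.
have [le1|gt1] := leqP #|rend U| 1; last first.
  have [z [z' [/rendP[zU szU] /rendP[z'U sz'U] zz']]] := card_gt1P gt1.
  apply/exists_inP; exists z => //; apply/exists_inP; exists z' => //.
  (* The run of U ending at z is closed under adjacency in U and misses z'. *)
  pose A y := exists i, z = iter i sg y /\ forall j, j <= i -> iter j sg y \in U.
  have A_step y w : A y -> induced adj U y w -> A w.
    move=> [i [Ei Ui]] /and3P[yU wU]; rewrite adjE => /orP[/eqP Ew|/eqP Ey].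
      case: i Ei Ui => [|i] Ei Ui.
        by case/negP: szU; rewrite Ei /= -Ew.
      exists i; rewrite Ew -iterSr; split=> // j ji; rewrite -iterSr.
      exact: Ui.
    exists i.+1; rewrite iterSr -Ey; split=> // -[|j] // ji.
    by rewrite iterSr -Ey Ui.
  apply/negP => /connectP[p pp Ez'].
  have: A (last z p).
    have: A z by exists 0; split=> // -[].
    elim: p (z) pp {Ez'} => //= w p IH y /andP[yw pp] Ay.
    exact: IH pp (A_step _ _ Ay yw).
  rewrite -Ez' => -[[|i] [Ei Ui]]; first by rewrite Ei eqxx in zz'.
  by have := Ui 1 isT; rewrite (negPf sz'U).
apply/negbTE/negP => /exists_inP[s sU /exists_inP[t tU /negP[]]].
suff [x cx] : exists x, {in U, forall t, connect (induced adj U) x t}.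
  by apply: connect_trans (cx t tU); rewrite (sym_connect_sym (@induced_sym U)) cx.
have [r0|] := posnP #|rend U|.
  have [U0|UT] := rend0 (cards0_eq r0); first by rewrite U0 inE in sU.
  exists s => w _; suff E : [set y | connect (induced adj U) s y] = setT.
    by have := in_setT w; rewrite -E inE.
  apply: (sg_closedT (x := s)) => [y|]; rewrite !inE ?connect0 // => sy.
  apply: connect_trans sy (connect1 _).
  by rewrite /induced /= UT !inE adjE eqxx.
move=> r1; have/eqP/cards1P[z rz] : #|rend U| = 1 by lia.
have [x [k [_ kU Ex kx]]] := rend1_index rz; exists x => w wU.
rewrite (Ex w wU); apply: (@arc_connect _ _ (k z)) => [i ik|]; last by rewrite -kU.
by rewrite kU kx.
Qed.

(** A path is connected, so it has at most one right end, and having none would make it the full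
    cycle. Conversely, an arc listed from its start by [traject] is a path. *)
Lemma is_pathE (I : {set S}) : is_path adj I = (#|rend I| == 1).
Proof.
apply/idP/cards1P => [|[z rI]].
  case/andP=> I0 /existsP[p /and3P[up /eqP Ip /forall_inP adjp]].
  have pE s t : s \in I -> t \in I ->
      adj s t = (index t p == (index s p).+1) || (index s p == (index t p).+1).
    by move=> sI tI; have /forall_inP/(_ t tI)/eqP := adjp s sI.
  have IpE y : (y \in I) = (y \in p) by rewrite [in LHS]Ip inE.
  have nodis : ~~ disconnected adj I.
    case/set0Pn: I0 => x0 x0I.
    have p0 : 0 < size p by rewrite size_tuple; apply/card_gt0P; exists x0.
    pose x := nth x0 p 0.
    have cI i : i < size p -> connect (induced adj I) x (nth x0 p i).
      elim: i => [|i IH] ip; first exact: connect0.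
      apply: connect_trans (IH (ltnW ip)) (connect1 _).
      have I1 : nth x0 p i \in I by rewrite IpE mem_nth // ltnW.
      have I2 : nth x0 p i.+1 \in I by rewrite IpE mem_nth.
      by rewrite /induced /= I1 I2 pE // !index_uniq // ?eqxx // ltnW.
    apply/negP => /exists_inP[s sI /exists_inP[t tI /negP[]]].
    have cx w : w \in I -> connect (induced adj I) x w.
      by rewrite IpE => wp; rewrite -(nth_index x0 wp) cI // index_mem.
    by apply: connect_trans (cx t tI); rewrite (sym_connect_sym (@induced_sym I)) cx.
  rewrite disconnectedE -leqNgt in nodis.
  have [r0|r1] := posnP #|rend I|; last by apply/cards1P/eqP; lia.
  have [I00|IT] := rend0 (cards0_eq r0); first by rewrite I00 eqxx in I0.
  (* In the full cycle the first vertex of p would have two neighbours. *)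
  case/set0Pn: I0 => x0 x0I.
  have p0 : 0 < size p by rewrite size_tuple; apply/card_gt0P; exists x0.
  have [w Ew] := sg_onto (nth x0 p 0).
  have ix : index (nth x0 p 0) p = 0 by rewrite index_uniq.
  have inI y : y \in I by rewrite IT inE.
  have inp y : y \in p by rewrite -IpE.
  have: adj (nth x0 p 0) (sg (nth x0 p 0)) by rewrite adjE eqxx.
  have: adj (nth x0 p 0) w by rewrite adjE -Ew eqxx orbT.
  rewrite !pE // ix !orbF => /eqP i1 /eqP i2.
  have /negP[] := sg2_neq w; rewrite -Ew; apply/eqP.
  by rewrite -(nth_index x0 (inp (sg _))) i2 -i1 nth_index.
have [x [k [cI kI Ex kx]]] := rend1_index rI.
have /rendP[zI szI] : z \in rend I by rewrite rI inE.
have I0 : I != set0 by apply/set0Pn; exists z.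
rewrite /is_path I0 /=; apply/existsP.
have szp : size (traject sg x #|I|) == #|I| by rewrite size_traject.
have kn i : i <= k z -> nth x (traject sg x #|I|) i = iter i sg x.
  by move=> ik; rewrite nth_traject // cI.
have un : uniq (traject sg x #|I|).
  apply/(uniqP x) => i j; rewrite cI !inE size_traject !ltnS => ik jk.
  by rewrite -cI !kn // => /(congr1 k); rewrite !kx.
have idx t : t \in I -> index t (traject sg x #|I|) = k t.
  move=> tI; have lt : k t < #|I| by rewrite cI ltnS -kI.
  by rewrite {1}(Ex t tI) -(nth_traject sg lt x) index_uniq // size_traject.
have EI : I == [set s in traject sg x #|I|].
  apply/eqP/setP=> t; rewrite inE; apply/idP/idP => [tI|].
    by rewrite -index_mem idx // size_traject cI ltnS -kI.
  by case/trajectP=> i; rewrite cI ltnS => ik ->; rewrite kI kx.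
have kS s t : s \in I -> t \in I -> (t == sg s) = (k t == (k s).+1).
  move=> sI tI; apply/eqP/eqP => [Et|Ek].
    have [sz|nz] := eqVneq s z; first by rewrite -sz -Et tI in szI.
    have ks : k s < k z.
      rewrite ltn_neqAle -kI sI andbT; apply: contra_neq nz => E.
      by rewrite (Ex s sI) E -Ex.
    by rewrite Et {1}(Ex s sI) -iterS kx.
  by rewrite (Ex t tI) Ek iterS -Ex.
exists (Tuple szp); rewrite un EI /=.
apply/forall_inP=> s sI; apply/forall_inP=> t tI; apply/eqP.
by rewrite adjE !kS // !idx.
Qed.

Lemma in_I1 (I : {set S}) : (I \in I1 adj) = (#|rend I| == 1) && odd #|I|.
Proof. by rewrite inE is_pathE. Qed.

Lemma ev_sub (I : {set S}) : ev adj I \subset I.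
Proof. by apply/subsetP=> t; rewrite inE => /andP[]. Qed.

(** A right end of the union is a right end of J or of K. Each of these has only one and the union
    needs two, so both survive: no vertex of one arc is followed by a vertex of the other. *)
Lemma spade_closed (J K : {set S}) : J \in I1 adj -> K \in I1 adj ->
  spade adj J K ->
  {in J, forall t, sg t \notin K} /\ {in K, forall t, sg t \notin J}.
Proof.
rewrite !in_I1 => /andP[/eqP rJ _] /andP[/eqP rK _] /andP[/eqP JK].
rewrite disconnectedE => gt1.
have sub : rend (J :|: K) \subset rend J :|: rend K.
  by apply/subsetP=> t; rewrite !inE; case: (t \in J); case: (t \in K);
    case: (sg t \in J); case: (sg t \in K).
have rJK : rend J :&: rend K = set0.
  by apply/setP=> t; have /setP/(_ t) := JK; rewrite !inE;
    case: (t \in J); case: (t \in K) => //=; rewrite andbF.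
have E : rend (J :|: K) = rend J :|: rend K.
  by apply/eqP; rewrite eqEcard sub cardsU rJK cards0 rJ rK.
have dis t : t \in J -> t \in K -> False.
  by move=> tJ tK; have /setP/(_ t) := JK; rewrite !inE tJ tK.
split=> t tI; apply/negP => stI; have /setP/(_ t) := E; rewrite !inE tI stI.
  by case: (boolP (sg t \in J)) => [/dis/(_ stI)//|]; rewrite ?orbT ?andbF.
by case: (boolP (sg t \in K)) => [/(dis _ stI)//|]; rewrite ?orbT ?andbF.
Qed.

(** * Even vertices of an odd arc *)

Lemma const_on_run (P : nat -> bool) i j :
  (forall l, i <= l < j -> P l.+1 = P l) -> forall l, i <= l <= j -> P l = P i.
Proof.
move=> H; elim=> [|l IH] /andP[il lj]; first by move: il; rewrite leqn0 => /eqP->.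
move: il; rewrite leq_eqVlt => /orP[/eqP->//|il].
by rewrite H ?IH //; apply/andP; split; lia.
Qed.

(** Removing t leaves the [k t] vertices before it and the vertices after it. As [#|I|] is odd,
    these two numbers have the same parity, and both pieces are odd arcs exactly when [k t] is
    odd. *)
Lemma in_ev_odd (I : {set S}) z x (k : S -> nat) :
    rend I = [set z] -> odd #|I| ->
    #|I| = (k z).+1 -> (forall t, (t \in I) = (k t <= k z)) ->
    {in I, forall t, t = iter (k t) sg x} ->
    (forall i, i <= k z -> k (iter i sg x) = i) ->
  {in I, forall t, (t \in ev adj I) = odd (k t)}.
Proof.
move=> rI oI cI kI Ex kx t tI.
have /rendP[zI szI] : z \in rend I by rewrite rI inE.
have kinj s u : s \in I -> u \in I -> k s = k u -> s = u.
  by move=> sI uI E; rewrite (Ex s sI) E -Ex.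
have kS s : s \in I -> (k s < k z) = (sg s \in I).
  move=> sI; apply/idP/idP => [ks|].
    by rewrite (Ex s sI) -iterS kI kx.
  move=> ssI; rewrite ltn_neqAle -kI sI andbT.
  by apply: contraNneq szI => /(kinj _ _ sI zI) <-.
have kSE s : s \in I -> k s < k z -> k (sg s) = (k s).+1.
  by move=> sI ks; rewrite {1}(Ex s sI) -iterS kx.
have inI i : i <= k z -> iter i sg x \in I by move=> ik; rewrite kI kx.
have kt : k t <= k z by rewrite -kI.
rewrite inE tI /=; apply/exists_inP/idP => [[J J1 /exists_inP[K K1]] | odt].
  (* [J'] is the piece holding the first vertex x. Membership in [J'] is constant along I on each
     side of t, so [J'] consists of the first [k t] vertices, and its odd size is [k t]. If [k t] is
     0 the same count makes [J'] empty, contradicting its oddness. *)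
  have key J' K' : J' \in I1 adj -> K' \in I1 adj -> I :\ t = J' :|: K' ->
      spade adj J' K' -> (k t == 0) || (x \in J') -> odd (k t).
    move=> J1' K1' EI sp xJ; have [clJ clK] := spade_closed J1' K1' sp.
    have /andP[/eqP JK _] := sp.
    have dis y : y \in J' -> y \in K' -> False.
      by move=> yJ yK; have /setP/(_ y) := JK; rewrite !inE yJ yK.
    have unI i : i <= k z -> i != k t -> (iter i sg x \in J') || (iter i sg x \in K').
      move=> ik it; have /setP/(_ (iter i sg x)) := EI; rewrite !inE inI // andbT => <-.
      by apply: contra_neq it => <-; rewrite kx.
    have JI y : (y \in J') || (y \in K') -> (y \in I) && (y != t).
      by have /setP/(_ y) := EI; rewrite !inE => <-; rewrite andbC.
    pose P i := iter i sg x \in J'.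
    have step l : l < k z -> l != k t -> l.+1 != k t -> P l.+1 = P l.
      move=> lz l1 l2; rewrite /P; have := unI l.+1 lz l2; have := unI l (ltnW lz) l1.
      case: (boolP (iter l sg x \in J')) => [lJ _|_ /= lK _].
        by rewrite orbC (negPf (clJ _ lJ)).
      exact/negbTE/clK.
    have nonempty (L : {set S}) : L \in I1 adj -> exists y, y \in L.
      by rewrite inE => /andP[/andP[/set0Pn]].
    have lo l : l < k t -> P l.
      move=> lt; have := xJ; rewrite (_ : (k t == 0) = false) /=; last by clear -lt; lia.
      move=> xJ'; rewrite (const_on_run (i := 0) (j := (k t).-1)) // ?xJ' //.
        by move=> l' /= l'k; apply: step; clear -l'k kt lt; lia.
      by clear -lt; lia.
    (* If the vertex after t were in [J'], so would be all later ones, leaving nothing for the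
       nonempty [K']. *)
    have hi l : k t < l <= k z -> ~~ P l.
      case/andP=> tl lz; have cst l' : k t < l' <= k z -> P l' = P (k t).+1.
        by apply: const_on_run => l'' /andP[tl' l'z]; apply: step; clear -tl' l'z; lia.
      rewrite cst ?tl //; apply/negP => Pt.
      have [y yK] := nonempty _ K1'.
      have /andP[yI yt] := JI y (ltac:(by rewrite yK orbT)).
      apply: (dis y) => //; rewrite (Ex y yI) -/(P _).
      have := yI; rewrite kI => ky; have [lt|gt|E] := ltngtP (k y) (k t).
      - exact: lo.
      - by rewrite cst // gt.
      by rewrite (kinj y t yI tI E) eqxx in yt.
    have EJ : J' =i take (k t) (traject sg x #|I|).
      move=> y; rewrite take_traject ?cI // 1?ltnW ?ltnS //.
      apply/idP/trajectP => [yJ|[i it ->]]; last exact: lo.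
      have /andP[yI yt] := JI y (ltac:(by rewrite yJ)); exists (k y); last exact: Ex.
      rewrite ltnNge; apply/negP => le; have: ~~ P (k y).
        apply: hi; rewrite -kI yI andbT ltn_neqAle le andbT.
        by apply: contra_neq yt => /esym/(kinj _ _ yI tI).
      by rewrite /P -Ex ?yJ.
    have <- : #|J'| = k t.
      rewrite (eq_card EJ) (card_uniqP _) ?size_take ?size_traject ?cI ?ltnS ?kt //.
      apply: take_uniq; apply/(uniqP x) => i j; rewrite !inE size_traject !ltnS => ik jk.
      by rewrite !nth_traject ?ltnS // => /(congr1 k); rewrite !kx.
    by move: J1'; rewrite inE => /andP[].
  case/andP=> /eqP EI sp; have [k0|k0] := eqVneq (k t) 0.
    by apply: (key J K) => //; rewrite k0.
  have: x \in I :\ t.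
    rewrite !inE (inI 0) // andbT; apply: contra_neq k0 => <-.
    exact: (kx 0).
  rewrite EI inE => /orP[xJ|xK]; first by apply: (key J K) => //; rewrite xJ orbT.
  apply: (key K J) => //; rewrite ?xK ?orbT 1?setUC //.
  by rewrite /spade setIC setUC.
(* The last position [k z] is even because [#|I|] is [(k z).+1], so a vertex at odd position is not
   the last one. *)
have tz : k t < k z by rewrite ltn_neqAle kt andbT; apply/eqP => E; move: oI; rewrite cI -E /= odt.
have [pt Ept] : exists pt, k t = pt.+1 by exists (k t).-1; move: odt; case: (k t).
pose J := [set y in I | k y < k t]; pose K := [set y in I | k t < k y].
have EI : I :\ t = J :|: K.
  apply/setP=> y; rewrite !inE andbC; case: (boolP (y \in I)) => //= yI.
  rewrite -neq_ltn; congr (~~ _); apply/eqP/eqP => [->//|].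
  exact: kinj.
have JK : J :&: K = set0.
  by apply/setP=> y; rewrite !inE; apply/negbTE/negP => /andP[/andP[_ ?] /andP[_ ?]]; lia.
have rJ : rend J = [set iter pt sg x].
  apply/setP=> y; rewrite !inE; apply/idP/eqP => [/andP[/andP[yI yt]]|->].
    have yz : k y < k z by lia.
    rewrite -(kS y yI) yz (kSE y) //= -leqNgt => ty.
    by rewrite {1}(Ex y yI); congr (iter _ _ _); lia.
  rewrite inI ?kx; [|lia..]; rewrite -iterS kx; last by lia.
  by rewrite Ept ltnSn ltnn andbF.
have rK : rend K = [set z].
  apply/setP=> y; rewrite !inE; apply/idP/eqP => [/andP[/andP[yI yt]]|->].
    rewrite negb_and -(kS y yI); case: (ltnP (k y) (k z)) => [yz|zy _] /=.
      by rewrite (kSE y) //= -leqNgt => ?; lia.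
    by apply: (kinj) => //; have := yI; rewrite kI; lia.
  by rewrite zI tz (negPf szI).
have cJ : #|J| = k t.
  have EJ : J =i traject sg x (k t).
    move=> y; rewrite inE; apply/idP/trajectP => [/andP[yI yt]|[i it ->]].
      by exists (k y) => //; apply: Ex.
    by rewrite inI ?kx //; lia.
  rewrite (eq_card EJ) (card_uniqP _) ?size_traject //.
  apply/(uniqP x) => i j; rewrite !inE size_traject => ik jk.
  by rewrite !nth_traject // => /(congr1 k); rewrite !kx //; lia.
have cK : odd #|K|.
  have := cardsD1 t I; rewrite tI EI cardsU JK cards0 subn0 cJ cI => E.
  by move: oI; rewrite cI E /= !oddD odt /= negbK.
exists J; first by rewrite in_I1 rJ cards1 cJ odt.
apply/exists_inP; exists K; first by rewrite in_I1 rK cards1 cK.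
rewrite EI eqxx /spade JK eqxx disconnectedE; apply/card_gt1P.
exists (iter pt sg x), z.
have kpt : k (iter pt sg x) = pt by rewrite kx //; lia.
split; last by apply/eqP => E; move: kpt; rewrite E; lia.
  rewrite !inE inI ?kpt ?Ept ?ltnSn -?iterS -?Ept -?Ex //=; last by lia.
  by rewrite Ept !ltnn !andbF.
by rewrite !inE zI tz orbT (negPf szI).
Qed.

(** Parity of position becomes a local alternation rule along [sg]: the first vertex, at position 0,
    is not even, and each later vertex is even iff its predecessor is not. Later arguments use this
    rule instead of positions. *)
Lemma ev_succ (I : {set S}) : I \in I1 adj ->
  forall t, (sg t \in ev adj I) = [&& sg t \in I, t \in I & t \notin ev adj I].
Proof.
rewrite in_I1 => /andP[/cards1P[z rI] oI] t.
have [x [k [cI kI Ex kx]]] := rend1_index rI.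
have evk := in_ev_odd rI oI cI kI Ex kx.
have [stI|/negPf stI] := boolP (sg t \in I); last first.
  by apply/negbTE; apply: contraFN stI; apply/subsetP/ev_sub.
rewrite evk //=; have [tI|tI] := boolP (t \in I) => /=.
  rewrite evk // -[LHS]negbK -/(odd (k (sg t)).+1) /=; congr (~~ _).
  have tz : k t < k z.
    rewrite ltn_neqAle -kI tI andbT; apply: contraTneq stI => E.
    have -> : t = z by rewrite (Ex t tI) E -Ex // kI.
    by have : z \in rend I by [rewrite rI inE]; case/rendP.
  by rewrite {1}(Ex t tI) -iterS kx //= negbK.
case E : (k (sg t)) => [|n] //; case/negP: tI.
have := Ex _ stI; rewrite E iterS => /sg_inj ->; rewrite kI kx; move: stI; rewrite kI E; lia.
Qed.

(** The alternation rule determines the set: any solution agrees with [ev adj I] outside I, in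
    particular just after the right end, and agreement propagates around the cycle. *)
Lemma ev_unique (I E : {set S}) : I \in I1 adj ->
  (forall t, (sg t \in E) = [&& sg t \in I, t \in I & t \notin E]) -> E = ev adj I.
Proof.
move=> I1I EP; have evP := ev_succ I1I.
have EI t : t \notin I -> (t \in E) = (t \in ev adj I).
  by have [w ->] := sg_onto t; rewrite EP evP => /negPf->.
have [z /rendP[_ szI]] : exists z, z \in rend I.
  by apply/card_gt0P; move: I1I; rewrite in_I1 => /andP[/eqP->].
pose D := [set t | (t \in E) == (t \in ev adj I)].
have inD t : (t \in D) = ((t \in E) == (t \in ev adj I)) by rewrite [in LHS]inE.
have DT : D = setT.
  apply: (sg_closedT (x := sg z)) => [t|]; rewrite !inD; last by rewrite EI.
  by rewrite EP evP => /eqP->.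
by apply/setP=> t; apply/eqP; rewrite -inD DT inE.
Qed.

End CyclicSuccessor.

(** * Singletons as members of a family *)

Section Singletons.
Local Open Scope nat_scope.
Variables (S : finType) (sg : S -> S) (adj : rel S).
Hypotheses (sgC : cyclic_succ sg)
  (adjE : forall s t, adj s t = (t == sg s) || (s == sg t)).

Lemma rend_set1 s : rend sg [set s] = [set s].
Proof.
apply/setP=> t; rewrite !inE; case: eqVneq => //= ->.
by rewrite (sg_neq sgC).
Qed.

Lemma set1_in_I1 s : [set s] \in I1 adj.
Proof. by rewrite (in_I1 sgC adjE) rend_set1 cards1. Qed.

Lemma ev_set1 s : ev adj [set s] = set0.
Proof.
apply/setP=> t; have [u ->] := sg_onto sgC t.
rewrite (ev_succ sgC adjE (set1_in_I1 s)) [RHS]inE !in_set1.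
by apply/negbTE/negP => /and3P[/eqP <- /eqP E _]; move: (sg_neq sgC u); rewrite -E eqxx.
Qed.

Lemma set1_phi s : [set [set s]] \in phi adj.
Proof.
rewrite inE sub1set set1_in_I1 /=; apply/andP; split; apply/forall_inP=> I /set1P ->.
  by apply/forall_inP=> J /set1P ->; rewrite eqxx.
apply/existsP; exists set0; rewrite sub0set ev_set1 sub0set andbT /=.
by apply/andP; split; [apply/trivIsetP=> ? ? | apply/forall_inP=> ?]; rewrite inE.
Qed.

Lemma I1_rend (I : {set S}) : I \in I1 adj -> exists z, rend sg I = [set z].
Proof. by rewrite (in_I1 sgC adjE) => /andP[/cards1P]. Qed.

Lemma phi_has_set1 (B : {set {set S}}) : B \in phi adj -> B != set0 ->
  exists s, [set s] \in B.
Proof.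
rewrite inE => /and3P[/subsetP BI _ /forall_inP pB] /set0Pn[I0 I0B].
(* A member of least cardinality has no smaller member below it, so its cover in [P1] is empty and
   it has no even vertices. *)
have [I IB minI] := arg_minnP (P := mem B) (fun I : {set S} => #|I|) I0B.
have /existsP[C /and4P[/subsetP CB _ /forall_inP Cprec evI]] := pB I IB.
have C0 : C = set0.
  apply/setP=> J; rewrite inE; apply/negbTE/negP => JC.
  by have /andP[/proper_card] := Cprec J JC; rewrite ltnNge (minI J (CB J JC)).
have ev0 t : t \in ev adj I -> False.
  by move/(subsetP evI); rewrite C0 /cover big_set0 inE.
have := BI I IB; rewrite (in_I1 sgC adjE) => /andP[/cards1P[z rI] _].
(* Of two consecutive vertices of an odd arc one is even, so here every vertex is a right end; an
   arc has only one. *)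
suff rII : rend sg I = I by exists z; rewrite -rI rII; exact: IB.
apply/setP=> t; rewrite inE andb_idr // => tI; apply/negP => stI.
have := ev_succ sgC adjE (BI I IB) t.
by rewrite stI tI; case: (boolP (t \in ev adj I)) => [/ev0 //|_ /= /ev0].
Qed.

End Singletons.

(** * Contracting three consecutive vertices *)

Section Contraction.
Local Open Scope nat_scope.
Variables (S : finType) (sg : S -> S) (adj : rel S).
Hypotheses (sgC : cyclic_succ sg)
  (adjE : forall s t, adj s t = (t == sg s) || (s == sg t)).
(** The vertex s of the reduction is the middle vertex [sg a]; writing s as a successor names both
    its neighbours. The block [h] stays a variable, to be instantiated with [hat (sg a)]. *)
Variables (a : S) (h : {set S}).
Hypothesis hE : h = [set a; sg a; sg (sg a)].

Local Notation T := (option {t : S | t \notin h}).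

(* The contracted cycle: None stands for the block h, which sg leaves from its last
   vertex sg (sg a). *)
Definition contract (t : S) : T := insub t.
Definition last_vertex (i : T) : S := if i is Some t then val t else sg (sg a).
Definition contract_succ (i : T) : T := contract (sg (last_vertex i)).
Definition blowup (U : {set T}) : {set S} := [set t | contract t \in U].

Lemma in_blowup U t : (t \in blowup U) = (contract t \in U).
Proof. by rewrite inE. Qed.

Lemma in_h t : (t \in h) = [|| t == a, t == sg a | t == sg (sg a)].
Proof. by rewrite hE !inE orbA. Qed.

Lemma contract_h t : t \in h -> contract t = None.
Proof. by move=> th; rewrite /contract insubF // th. Qed.

Lemma contractN t : t \notin h -> exists u, contract t = Some u /\ val u = t.
Proof. by move=> th; rewrite /contract insubT; exists (Sub t th). Qed.

Lemma contract0 : contract a = None.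
Proof. by rewrite contract_h // in_h eqxx. Qed.

Lemma contract1 : contract (sg a) = None.
Proof. by rewrite contract_h // in_h eqxx orbT. Qed.

Lemma contract2 : contract (sg (sg a)) = None.
Proof. by rewrite contract_h // in_h eqxx !orbT. Qed.

Lemma last_vertexK : cancel last_vertex contract.
Proof. by case=> [t|] /=; [apply: valK | apply: contract2]. Qed.

Lemma last_vertex_neq i : (last_vertex i != a) && (last_vertex i != sg a).
Proof.
case: i => [[t /= th]|] /=; last by rewrite (sg2_neq sgC) (sg_neq sgC).
by move: th; rewrite in_h !negb_or => /and3P[-> ->].
Qed.

Lemma contractK t : t != a -> t != sg a -> last_vertex (contract t) = t.
Proof.
move=> ta tb; have [th|/contractN[u [-> //]]] := boolP (t \in h).
rewrite contract_h //=; apply/eqP; move: th.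
by rewrite in_h (negPf ta) (negPf tb) /= eq_sym.
Qed.

(** At the two excluded vertices the step by [sg] stays inside the block, where [contract] is
    constant; this accounts for the case splits on a and [sg a] below. *)
Lemma contract_sg t : t != a -> t != sg a ->
  contract (sg t) = contract_succ (contract t).
Proof. by move=> ta tb; rewrite /contract_succ contractK. Qed.

Lemma card_h : #|h| = 3.
Proof.
rewrite hE setUC cardsU1 cards2 !inE negb_or (sg2_neq sgC) (sg_neq sgC).
by rewrite eq_sym (sg_neq sgC).
Qed.

Lemma card_contract : #|{: T}| = (#|S| - 3).+1.
Proof.
rewrite card_option card_sig -card_h -(cardsC h) addKn; congr _.+1.
by apply: eq_card => t; rewrite !inE.
Qed.

Lemma blowup_inj : injective blowup.
Proof.
move=> U V /setP E; apply/setP=> i; have := E (last_vertex i).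
by rewrite !in_blowup last_vertexK.
Qed.

Lemma contract_cyclic : 5 <= #|S| -> cyclic_succ contract_succ.
Proof.
move=> S5; split; last 1 first.
- move=> U clU.
  have cl : {in blowup U, forall t, sg t \in blowup U}.
    move=> t; rewrite !in_blowup; have [->|ta] := eqVneq t a.
      by rewrite contract0 contract1.
    have [->|tb] := eqVneq t (sg a); first by rewrite contract1 contract2.
    by rewrite contract_sg //; apply: clU.
  have [E|E] := sg_closed sgC cl; [left | right]; apply/setP=> i;
    by rewrite -[i]last_vertexK -in_blowup E !inE.
- move=> i j E; apply: (can_inj last_vertexK); apply: (sg_inj sgC).
  have := E; rewrite /contract_succ.
  (* The block can be entered only at a, because [last_vertex k] is neither a nor [sg a]. *)
  have aux k : contract (sg (last_vertex k)) = None -> sg (last_vertex k) = a.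
    move=> Ek; have: sg (last_vertex k) \in h.
      by apply: contraT => /contractN[u [Eu]]; rewrite Eu in Ek.
    have /andP[ka kb] := last_vertex_neq k.
    by rewrite in_h !(inj_eq (sg_inj sgC)) (negPf ka) (negPf kb) !orbF => /eqP.
  case Ei : (contract (sg (last_vertex i))) => [u|] Ej.
    have val_contract k v : contract k = Some v -> k = val v.
      rewrite /contract; case: insubP => // w _ <- [<-] //.
    by rewrite (val_contract _ _ Ei) (val_contract _ _ (esym Ej)).
  by rewrite (aux _ Ei) (aux j).
by rewrite card_contract; lia.
Qed.

(** The vertices a and [sg a] are never right ends of a blowup, since their successors contract to
    the same point; elsewhere [contract] and [last_vertex] are inverse to each other. *)
Lemma rend_blowup U : rend sg (blowup U) = last_vertex @: rend contract_succ U.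
Proof.
apply/setP=> t; apply/idP/imsetP => [|[i ir ->]].
  case/rendP; rewrite !in_blowup => tU stU.
  have ta : t != a by apply: contraNneq stU => E; rewrite E contract1 -contract0 -E.
  have tb : t != sg a by apply: contraNneq stU => E; rewrite E contract2 -contract1 -E.
  exists (contract t); last by rewrite contractK.
  by apply/rendP; rewrite -contract_sg.
by case/rendP: ir => iU siU; apply/rendP; rewrite !in_blowup last_vertexK.
Qed.

Lemma card_rend_blowup U : #|rend sg (blowup U)| = #|rend contract_succ U|.
Proof. by rewrite rend_blowup card_imset //; apply: can_inj last_vertexK. Qed.

Lemma card_blowup U : #|blowup U| = #|U| + (if None \in U then 2 else 0).
Proof.
pose A : {set S} := if None \in U then [set a; sg a] else set0.
have -> : blowup U = last_vertex @: U :|: A.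
  apply/setP=> t; rewrite !inE; apply/idP/orP => [tU|[/imsetP[i iU ->]|]].
  - have [Et|ta] := eqVneq t a.
      by right; move: tU; rewrite /A Et contract0 => ->; rewrite !inE eqxx.
    have [Et|tb] := eqVneq t (sg a).
      by right; move: tU; rewrite /A Et contract1 => ->; rewrite !inE eqxx orbT.
    by left; apply/imsetP; exists (contract t); rewrite ?contractK.
  - by rewrite last_vertexK.
  rewrite /A; case: ifP => [NU|_]; last by rewrite inE.
  by rewrite !inE => /orP[] /eqP ->; rewrite ?contract0 ?contract1.
have dis : [disjoint last_vertex @: U & A].
  rewrite disjoints_subset; apply/subsetP=> t /imsetP[i _ ->].
  have /andP[ia ib] := last_vertex_neq i.
  by rewrite inE /A; case: ifP; rewrite !inE // negb_or ia ib.
rewrite cardsU disjoint_setI0 // cards0 subn0 card_imset; last exact: can_inj last_vertexK.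
rewrite /A; case: ifP; rewrite ?cards0 // cards2 eq_sym (sg_neq sgC) //.
Qed.

Lemma odd_blowup U : odd #|blowup U| = odd #|U|.
Proof. by rewrite card_blowup oddD; case: ifP; rewrite addbF. Qed.

Lemma blowup_saturated (I : {set S}) :
    (a \in I) = (sg a \in I) -> (sg (sg a) \in I) = (sg a \in I) ->
  exists J, I = blowup J.
Proof.
move=> Ea Eb; exists [set i | last_vertex i \in I]; apply/setP=> t.
rewrite !inE; have [->|ta] := eqVneq t a; first by rewrite contract0 /= Eb.
have [->|tb] := eqVneq t (sg a); first by rewrite contract1 /= Eb.
by rewrite contractK.
Qed.

(** The last hypothesis is orthogonality of e_I to e_s with s = [sg a]. The proof examines how I can
    meet the block when a and [sg a] are not both inside or both outside. *)
Lemma arc_saturated (I : {set S}) : odd #|S| -> I \in I1 adj ->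
    (a \in I) = (sg (sg a) \in I) ->
  I = [set sg a] \/ exists J, I = blowup J.
Proof.
move=> oS I1I Eab; have [z rI] := I1_rend sgC adjE I1I.
have rIP t : t \in I -> sg t \notin I -> t = z.
  by move=> tI stI; apply/set1P; rewrite -rI inE tI stI.
have [Es|Es] := eqVneq (a \in I) (sg a \in I).
  by right; apply: blowup_saturated; rewrite -?Eab.
have [aI|aI] := boolP (a \in I).
  have sI : sg a \notin I by move: Es; rewrite aI; case: (sg a \in I).
  (* Here I contains a and [sg (sg a)] but not [sg a], so a is its only right end and I is
     everything except [sg a]: an even number of vertices. *)
  have cl : {in sg a |: I, forall t, sg t \in sg a |: I}.
    move=> t; rewrite !inE => /orP[/eqP->|tI]; first by rewrite -Eab aI orbT.
    by case: (boolP (sg t \in I)) => [|/(rIP _ tI) ->]; rewrite ?orbT // (rIP _ aI sI) eqxx.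
  have E := sg_closedT sgC (x := sg a) cl (ltac:(by rewrite !inE eqxx)).
  have := oS; rewrite -cardsT -E cardsU1 sI /=.
  by move: I1I; rewrite inE => /andP[_ ->].
have sI : sg a \in I by move: Es; rewrite (negPf aI); case: (sg a \in I).
have sz := rIP _ sI (ltac:(by rewrite -Eab)).
(* Now [sg a] is the only right end and also begins a run, so the rest of I is invariant and must be
   empty. *)
left; have cl : {in I :\ sg a, forall t, sg t \in I :\ sg a}.
  move=> t; rewrite !inE (inj_eq (sg_inj sgC)) => /andP[ta tI].
  apply/andP; split; first by apply: contraNneq aI => <-.
  by apply: contraT => /(rIP _ tI) Et; rewrite Et -sz eqxx in ta.
case: (sg_closed sgC cl) => E; last by have := in_setT (sg a); rewrite -E !inE eqxx.
by rewrite -(setD1K sI) E setU0.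
Qed.

(** * Lifting a family from the contracted cycle *)

Definition blowup_basis (B : {set {set T}}) : {set {set S}} :=
  [set sg a] |: [set blowup J | J in B].

Lemma set1_neq_blowup J : [set sg a] != blowup J.
Proof.
apply/eqP=> /setP E; have := E (sg a); have := E (sg (sg a)).
rewrite !in_blowup contract1 contract2 => <-.
by rewrite !inE eqxx (negPf (sg_neq sgC _)).
Qed.

Lemma mem_blowup_basis B J : (blowup J \in blowup_basis B) = (J \in B).
Proof.
rewrite !inE eq_sym (negPf (set1_neq_blowup J)) /=.
by apply/imsetP/idP => [[K KB /blowup_inj->//]|JB]; exists J.
Qed.

Lemma card_blowup_basis B : #|blowup_basis B| = #|B|.+1.
Proof.
rewrite cardsU1 card_imset; last exact: blowup_inj.
case: imsetP => // -[J _ E]; have := set1_neq_blowup J.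
by rewrite -E eqxx.
Qed.

(** By [P0], every other member J is comparable with, or apart from, the singleton s. In each case J
    contains the whole block or misses it, which makes it a blowup. *)
Lemma phi_blowup_basis (B : {set {set S}}) : B \in phi adj -> [set sg a] \in B ->
  exists B', B = blowup_basis B'.
Proof.
move=> Bphi aB; exists [set J | blowup J \in B].
have sub J : J \in B -> J != [set sg a] -> exists K, J = blowup K.
  move: Bphi; rewrite inE => /and3P[/subsetP BI /forall_inP P0B _] JB Ja.
  have /forall_inP/(_ J JB) := P0B _ aB.
  rewrite eq_sym (negPf Ja) /=.
  have [z rJ] := I1_rend sgC adjE (BI J JB).
  have rJP t : t \in J -> sg t \notin J -> t = z.
    by move=> tJ stJ; apply/set1P; rewrite -rJ inE tJ.
  case/or3P.
  - case/andP=> /eqP/setP dis; rewrite (disconnectedE sgC adjE) => gt1.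
    have aJ : sg a \notin J.
      by have := dis (sg a); rewrite !inE eqxx /= => ->.
    have contr (w : S) : rend sg ([set sg a] :|: J) \subset [set w] -> False.
      by move/subset_leq_card; rewrite cards1 leqNgt gt1.
    (* If J contained a neighbour of s, adding s would only extend J at one end, and the union would
       have a single right end. *)
    apply: blowup_saturated; rewrite (negPf aJ); apply/negbTE/negP => xJ.
      have Ez := rJP _ xJ aJ; apply: (contr (sg a)); apply/subsetP=> t.
      rewrite !inE; case: eqVneq => //= _ /andP[tJ]; rewrite negb_or => /andP[].
      by move=> nta /(rJP _ tJ) Et; rewrite Et -Ez eqxx in nta.
    apply: (contr z); apply/subsetP=> t; rewrite !inE negb_or.
    case: eqVneq => [->|_] /=; first by rewrite xJ andbF.
    by case/and3P=> tJ _ /(rJP _ tJ) ->.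
  - rewrite /prec properEneq sub1set (disconnectedE sgC adjE) => /andP[/andP[_ aJ] gt1].
    have contr (w : S) : rend sg (J :\ sg a) \subset [set w] -> False.
      by move/subset_leq_card; rewrite cards1 leqNgt gt1.
    (* If J missed a neighbour of s, then s would be an end of J, and removing it would leave at
       most one right end. *)
    apply: blowup_saturated; rewrite aJ; apply/negPn/negP => xJ.
      apply: (contr z); apply/subsetP=> t; rewrite !inE negb_and negbK.
      case/andP=> /andP[ta tJ] /orP[|/(rJP _ tJ)->//].
      by rewrite (inj_eq (sg_inj sgC)) => /eqP Et; rewrite -Et tJ in xJ.
    have Ez := rJP _ aJ xJ; apply: (contr a); apply/subsetP=> t; rewrite !inE negb_and negbK.
    case/andP=> /andP[ta tJ] /orP[|/(rJP _ tJ) Et]; first by rewrite (inj_eq (sg_inj sgC)).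
    by rewrite Et -Ez eqxx in ta.
  case/andP=> /properP[/subsetP sJ [x]]; rewrite inE => /eqP -> aJ _.
  have [zJ _] : z \in J /\ sg z \notin J by apply/rendP; rewrite rJ inE.
  by have := sJ z zJ; rewrite inE => /eqP E; rewrite -E zJ in aJ.
apply/setP=> J; rewrite !inE; have [->|Ja] := eqVneq J [set sg a]; first by rewrite aB.
apply/idP/imsetP => [JB|[K]]; last by rewrite inE => KB ->.
by have [K EK] := sub J JB Ja; exists K; rewrite ?inE -?EK.
Qed.

(** For three vertices the block is the whole cycle, so a blowup is empty or full and has no right
    end. In the base case this leaves only the singleton in a lifted family. *)
Lemma blowup_card3 J : #|S| = 3 -> blowup J \notin I1 adj.
Proof.
move=> S3; apply/negP=> /(I1_rend sgC adjE)[z /setP rJ].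
have hT t : t \in h.
  suff -> : h = setT by rewrite inE.
  by apply/eqP; rewrite eqEcard subsetT cardsT card_h S3.
have := rJ z; rewrite !inE eqxx (contract_h (hT _)) (contract_h (hT _)).
by rewrite andbN.
Qed.

(** * Transfer of [phi] across the contraction *)

Section Large.
Hypothesis S5 : 5 <= #|S|.
Variable adj' : rel T.
Hypothesis adj'E :
  forall i j, adj' i j = (j == contract_succ i) || (i == contract_succ j).

Let sgC' := contract_cyclic S5.

Lemma blowup_I1 J : (blowup J \in I1 adj) = (J \in I1 adj').
Proof. by rewrite (in_I1 sgC adjE) (in_I1 sgC' adj'E) card_rend_blowup odd_blowup. Qed.

Lemma blowup_disconnected U : disconnected adj (blowup U) = disconnected adj' U.
Proof. by rewrite (disconnectedE sgC adjE) (disconnectedE sgC' adj'E) card_rend_blowup. Qed.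

Lemma blowupU U V : blowup (U :|: V) = blowup U :|: blowup V.
Proof. by apply/setP=> t; rewrite !inE. Qed.

Lemma blowupI U V : blowup (U :&: V) = blowup U :&: blowup V.
Proof. by apply/setP=> t; rewrite !inE. Qed.

Lemma blowupD U V : blowup (U :\: V) = blowup U :\: blowup V.
Proof. by apply/setP=> t; rewrite !inE. Qed.

Lemma blowup0 : blowup set0 = set0.
Proof. by apply/setP=> t; rewrite !inE. Qed.

Lemma blowup_subset U V : (blowup U \subset blowup V) = (U \subset V).
Proof. by rewrite -!setD_eq0 -blowupD -blowup0 (inj_eq blowup_inj). Qed.

Lemma blowup_spade U V : spade adj (blowup U) (blowup V) = spade adj' U V.
Proof.
by rewrite /spade -blowupU -blowupI blowup_disconnected -blowup0 (inj_eq blowup_inj).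
Qed.

Lemma blowup_prec U V : prec adj (blowup U) (blowup V) = prec adj' U V.
Proof. by rewrite /prec !properE !blowup_subset -blowupD blowup_disconnected. Qed.

(** Inside the block the alternation flips at the middle vertex and returns to the value of [None]
    at the last one. The right-hand side obeys the alternation rule, so [ev_unique] applies. *)
Lemma ev_blowup J : J \in I1 adj' -> forall t,
  (t \in ev adj (blowup J)) =
  if t == sg a then (None \in J) && (None \notin ev adj' J) else contract t \in ev adj' J.
Proof.
move=> J1; pose E := [set t | if t == sg a then (None \in J) && (None \notin ev adj' J)
                              else contract t \in ev adj' J].
have inE' t : (t \in E) = if t == sg a then (None \in J) && (None \notin ev adj' J)
                              else contract t \in ev adj' J by rewrite [LHS]in_set.
have evJ i : i \in ev adj' J -> i \in J by apply/subsetP/ev_sub.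
move=> t; rewrite -inE'; congr (t \in pred_of_set _); apply/esym.
have sp0 := sg_neq sgC a.
apply: (ev_unique sgC adjE); first by rewrite blowup_I1.
move=> {}t; rewrite !inE' !in_blowup (inj_eq (sg_inj sgC)).
have [->|ta] := eqVneq t a.
  by rewrite eq_sym (negPf sp0) contract0 contract1; case: (None \in J).
have [->|tb] := eqVneq t (sg a).
  rewrite contract1 contract2 negb_and negbK.
  by case: (boolP (None \in ev adj' J)) => [/evJ->//|_]; rewrite orbF andbA andbb andbN.
by rewrite contract_sg // (ev_succ sgC' adj'E J1).
Qed.

(** The two right ends of the union are [sg a], whose successor is in the block, and the right end
    of the blowup, whose successor is not [sg a] because a is outside. *)
Lemma set1_spade_blowup J : J \in I1 adj' -> None \notin J ->
  spade adj [set sg a] (blowup J).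
Proof.
move=> J1 NJ; have [z rJ] : exists z, rend sg (blowup J) = [set z].
  by apply: (I1_rend sgC adjE); rewrite blowup_I1.
have [zJ szJ] : z \in blowup J /\ sg z \notin blowup J by apply/rendP; rewrite rJ inE.
have nJ t : contract t = None -> t \notin blowup J by move=> E; rewrite inE E.
rewrite /spade (disconnectedE sgC adjE); apply/andP; split.
  apply/eqP/setP=> t; rewrite in_setI in_set1 [RHS]inE; case: eqVneq => //= ->.
  exact/negbTE/nJ/contract1.
apply/card_gt1P; exists (sg a), z; split.
- apply/rendP; rewrite !in_setU !in_set1 eqxx negb_or (sg_neq sgC); split=> //.
  exact/nJ/contract2.
- apply/rendP; rewrite !in_setU zJ orbT in_set1 (inj_eq (sg_inj sgC)) negb_or szJ.
  split=> //; rewrite andbT; apply: contraTneq zJ => ->; exact/nJ/contract0.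
by apply: contraTneq zJ => <-; apply/nJ/contract1.
Qed.

(** Removing the middle vertex makes a a right end. The right end of the blowup stays one, as it
    differs from a and from [sg a], whose successors lie in the blowup. *)
Lemma set1_prec_blowup J : J \in I1 adj' -> None \in J ->
  prec adj [set sg a] (blowup J).
Proof.
move=> J1 NJ; have [z rJ] : exists z, rend sg (blowup J) = [set z].
  by apply: (I1_rend sgC adjE); rewrite blowup_I1.
have [zJ szJ] : z \in blowup J /\ sg z \notin blowup J by apply/rendP; rewrite rJ inE.
have inJ t : contract t = None -> t \in blowup J by move=> E; rewrite inE E.
have sp0 := sg_neq sgC a.
rewrite /prec (disconnectedE sgC adjE); apply/andP; split.
  rewrite properEneq sub1set (inJ _ contract1) andbT; exact: set1_neq_blowup.
have za : z != a by apply: contraNneq szJ => ->; apply/inJ/contract1.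
have zb : z != sg a by apply: contraNneq szJ => ->; apply/inJ/contract2.
apply/card_gt1P; exists a, z; split; last by rewrite eq_sym.
  by apply/rendP; rewrite !in_setD !in_set1 eqxx (inJ _ contract0) eq_sym sp0.
by apply/rendP; rewrite !in_setD !in_set1 zJ zb negb_and szJ orbT.
Qed.

Lemma blowup_basis_phi B : (blowup_basis B \in phi adj) = (B \in phi adj').
Proof.
have inBs J : (blowup J \in blowup_basis B) = (J \in B) := mem_blowup_basis B J.
have aBs : [set sg a] \in blowup_basis B by rewrite !inE eqxx.
have BsP I : I \in blowup_basis B -> I = [set sg a] \/ exists2 J, J \in B & I = blowup J.
  by rewrite !inE => /orP[/eqP->|/imsetP[J JB ->]]; [left | right; exists J].
rewrite !inE.
have <- : (blowup_basis B \subset I1 adj) = (B \subset I1 adj').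
  apply/subsetP/subsetP => sB I; first by rewrite -inBs -blowup_I1; apply: sB.
  by case/BsP=> [->|[J JB ->]]; rewrite ?(set1_in_I1 sgC adjE) ?blowup_I1 ?sB.
case: (boolP (_ \subset _)) => //= /subsetP BI1.
have BI J : J \in B -> J \in I1 adj' by rewrite -inBs -blowup_I1; apply: BI1.
have -> : P0 adj (blowup_basis B) = P0 adj' B.
  apply/forall_inP/forall_inP => PB I IB; apply/forall_inP=> J JB.
    have /forall_inP/(_ (blowup J)) := PB (blowup I) (ltac:(by rewrite inBs)).
    by rewrite inBs (inj_eq blowup_inj) blowup_spade !blowup_prec; apply.
  have aP K : K \in B -> spade adj [set sg a] (blowup K) || prec adj [set sg a] (blowup K).
    move=> KB; have [NK|NK] := boolP (None \in K).
      by rewrite set1_prec_blowup ?orbT ?BI.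
    by rewrite set1_spade_blowup ?BI.
  case/BsP: IB => [->|[I' IB ->]]; case/BsP: JB => [->|[J' JB ->]].
  - by rewrite eqxx.
  - by have := aP _ JB => /orP[->|->]; rewrite ?orbT.
  - have := aP _ IB => /orP[sp|->]; rewrite ?orbT //.
    by rewrite (_ : spade _ _ _) ?orbT // /spade setIC setUC.
  have /forall_inP/(_ J' JB) := PB _ IB.
  by rewrite (inj_eq blowup_inj) blowup_spade !blowup_prec.
congr (_ && _); apply/forall_inP/forall_inP => PB I IB.
  have /existsP[C /and4P[/subsetP CB /trivIsetP Cdis /forall_inP Cprec /subsetP Ccov]] :=
    PB (blowup I) (ltac:(by rewrite inBs)).
  apply/existsP; exists [set K | blowup K \in C]; apply/and4P; split.
  - by apply/subsetP=> K; rewrite inE => /CB; rewrite inBs.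
  - apply/trivIsetP=> K L; rewrite !inE => KC LC KL.
    have := Cdis _ _ KC LC; rewrite (inj_eq blowup_inj) => /(_ KL).
    by rewrite -!setI_eq0 -blowupI -blowup0 (inj_eq blowup_inj).
  - by apply/forall_inP=> K; rewrite inE => /Cprec; rewrite blowup_prec.
  (* An even vertex i lifts to [last_vertex i], which is never [sg a]; the member of C covering it
     is therefore a blowup and not the singleton. *)
  apply/subsetP=> i iev; have /andP[_ ib] := last_vertex_neq i.
  have : last_vertex i \in ev adj (blowup I).
    by rewrite ev_blowup ?BI // (negPf ib) last_vertexK.
  case/Ccov/bigcupP=> K KC; have [EK|[L LB EK]] := BsP K (CB K KC).
    by rewrite EK inE (negPf ib).
  rewrite EK in_blowup last_vertexK => iL; apply/bigcupP; exists L => //.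
  by rewrite inE -EK.
case/BsP: IB => [->|[J JB ->]].
  apply/existsP; exists set0; rewrite sub0set (ev_set1 sgC adjE) sub0set andbT /=.
  apply/andP; split; first by apply/trivIsetP=> ? ?; rewrite inE.
  by apply/forall_inP=> ?; rewrite inE.
have /existsP[C /and4P[/subsetP CB /trivIsetP Cdis /forall_inP Cprec /subsetP Ccov]] :=
  PB J JB.
(* The singleton joins the lifted cover exactly when J contains [None] but C does not cover it. Then
   [None] is not even, so [sg a] becomes even and needs covering; if C does cover [None], a lifted
   member already contains [sg a], and adding the singleton would break disjointness. *)
pose A : {set {set S}} :=
  if (None \in J) && (None \notin cover C) then [set [set sg a]] else set0.
have AP K : K \in A -> [/\ K = [set sg a], None \in J & None \notin cover C].
  by rewrite /A; case: ifP => [/andP[-> ->]|_]; rewrite inE // => /eqP.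
have dis K : [set sg a] \in A -> K \in C -> [disjoint [set sg a] & blowup K].
  case/AP=> _ _ Ncov KC; rewrite disjoints1 inE contract1.
  by apply: contraNN Ncov => NK; apply/bigcupP; exists K.
apply/existsP; exists (A :|: [set blowup K | K in C]); apply/and4P; split.
- apply/subsetP=> K; rewrite in_setU => /orP[/AP[-> _ _] //|/imsetP[L LC ->]].
  by rewrite inBs CB.
- apply/trivIsetP=> K L; rewrite !in_setU.
  case/orP=> [KA|/imsetP[K' KC ->]] /orP[LA|/imsetP[L' LC ->]].
  + by have [-> _ _] := AP _ KA; have [-> _ _] := AP _ LA; rewrite eqxx.
  + by have [E _ _] := AP _ KA; rewrite E in KA * => _; apply: dis.
  + have [E _ _] := AP _ LA; rewrite E in LA * => _; rewrite disjoint_sym; exact: dis.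
  rewrite (inj_eq blowup_inj) => /(Cdis _ _ KC LC).
  by rewrite -!setI_eq0 -blowupI -blowup0 (inj_eq blowup_inj).
- apply/forall_inP=> K; rewrite in_setU => /orP[/AP[-> NJ _]|/imsetP[L LC ->]].
    by apply: set1_prec_blowup => //; apply: BI.
  by rewrite blowup_prec Cprec.
apply/subsetP=> t; rewrite ev_blowup ?BI //; case: eqVneq => [->|_].
  case/andP=> NJ _; have [/bigcupP[K KC NK]|Ncov] := boolP (None \in cover C).
    apply/bigcupP; exists (blowup K); last by rewrite inE contract1.
    by rewrite in_setU imset_f ?orbT.
  by apply/bigcupP; exists [set sg a]; rewrite ?in_setU /A ?NJ ?Ncov !inE eqxx.
case/Ccov/bigcupP=> K KC tK; apply/bigcupP; exists (blowup K); last by rewrite inE.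
by rewrite in_setU imset_f ?orbT.
Qed.

End Large.

End Contraction.

(** * Reduction of a circular family *)

Lemma F2_eq0_or1 (c : 'F_2) : c = 0 \/ c = 1.
Proof. by case: c => [[|[|]] //] ?; [left | right]; apply: val_inj. Qed.

Lemma F2_addvv (V : lmodType 'F_2) (v : V) : v + v = 0.
Proof. by rewrite -[v]scale1r -scalerDl (_ : 1 + 1 = 0 :> 'F_2) ?scale0r //; apply: val_inj. Qed.

Lemma F2_natr_addb (b c : bool) : b%:R + c%:R = (b (+) c)%:R :> 'F_2.
Proof. by case: b; case: c; apply: val_inj. Qed.

Lemma F2_natr_eq0 (b : bool) : (b%:R == 0 :> 'F_2) = ~~ b.
Proof. by case: b. Qed.

(** [vset] and [Lset] restate e_I and L_B for an arbitrary [form_family], so that the induction can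
    pass to reductions; on [Vbar] they unfold to [ebar_set] and [LB]. *)
Definition vset (X : form_family) (U : {set Defs.findex X}) : fspace X :=
  \sum_(s in U) fvec s.

Definition Lset (X : form_family) (B : {set {set Defs.findex X}}) :
    {vspace fspace X} :=
  <<[seq vset J | J in B]>>%VS.

(** These are the properties carried by the induction. The last two say that the total sum is the
    only nontrivial linear relation; over F_2 relations are subset sums, hence the formulation by
    sets. *)
Record circular (X : form_family) (sg : Defs.findex X -> Defs.findex X) : Prop :=
  Circular {
    circ_succ : cyclic_succ sg;
    circ_odd : odd #|Defs.findex X|;
    circ_alt : forall x, fform X x x = 0;
    circ_form : forall s t : Defs.findex X,
      fform X (fvec s) (fvec t) = ((t == sg s) || (s == sg t))%:R;
    circ_sum : vset [set: Defs.findex X] = 0;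
    circ_ker : forall U : {set Defs.findex X}, vset U = 0 -> U = set0 \/ U = setT }.

Lemma memv_Lset (X : form_family) (B : {set {set Defs.findex X}}) J :
  J \in B -> vset J \in Lset B.
Proof. by move=> JB; apply: memv_span; apply: image_f. Qed.

Lemma Lset_sub (X : form_family) (B : {set {set Defs.findex X}}) (W : {vspace fspace X}) :
  (forall J, J \in B -> vset J \in W) -> (Lset B <= W)%VS.
Proof. by move=> BW; apply/span_subvP=> v /imageP[J JB ->]; apply: BW. Qed.

Lemma Lset0 (X : form_family) : Lset (set0 : {set {set Defs.findex X}}) = 0%VS.
Proof. by apply/eqP; rewrite -subv0; apply: Lset_sub => J; rewrite inE. Qed.

Lemma natr_sum_eq (T : finType) (U : {set T}) (a : T) :
  \sum_(t in U) (t == a)%:R = (a \in U)%:R :> 'F_2.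
Proof.
have [aU|aU] := boolP (a \in U); last first.
  by apply: big1 => t tU; case: eqP => // E; rewrite -E tU in aU.
by rewrite (bigD1 a) //= eqxx big1 ?addr0 // => t /andP[_ /negPf->].
Qed.

Section CircularFamily.
Variables (X : form_family) (sg : Defs.findex X -> Defs.findex X).
Hypothesis circX : circular sg.
Let sgC : cyclic_succ sg := circ_succ circX.

Lemma circ_sym x y : fform X x y = fform X y x.
Proof.
have := circ_alt circX (x + y).
rewrite linearDl !linearD /= !(circ_alt circX) addr0 add0r => /eqP.
by rewrite addr_eq0 => /eqP ->; case: (F2_eq0_or1 (fform X y x)) => ->; apply: val_inj.
Qed.

Lemma form_vset (U : {set Defs.findex X}) t :
  fform X (vset U) (fvec (sg t)) = ((t \in U) (+) (sg (sg t) \in U))%:R.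
Proof.
rewrite linear_sumlz -F2_natr_addb -!natr_sum_eq -big_split /=.
apply: eq_bigr => s _; rewrite (circ_form circX) F2_natr_addb (inj_eq (sg_inj sgC)) eq_sym.
by case: eqVneq => // ->; rewrite eq_sym (negPf (sg2_neq sgC t)).
Qed.

Variable a : Defs.findex X.

Lemma hatE : hat (sg a) = [set a; sg a; sg (sg a)].
Proof.
apply/setP=> t; rewrite !inE (circ_form circX) (inj_eq (sg_inj sgC)).
by rewrite [a == t]eq_sym; case: (t == a); case: (t == sg a); case: (t == _).
Qed.

Notation ctr := (@contract _ (hat (sg a))).
Notation blow := (@blowup _ (hat (sg a))).
Notation X' := (reduction (sg a)).

(** The map p_s extended to the whole space by the projection onto [perp]; it has its intended
    meaning on [perp], and membership there is tracked separately. *)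
Definition red_map : 'Hom(fspace X, red_space (sg a)) :=
  (red_pi (sg a) \o linfun (vsproj (perp (sg a))))%VF.

Lemma red_mapE v : red_map v = red_pi (sg a) (vsproj (perp (sg a)) v).
Proof. by rewrite comp_lfunE; congr (red_pi _ _); rewrite lfunE. Qed.

Lemma fvec_perp : fvec (sg a) \in perp (sg a).
Proof. by rewrite mem_orthv (circ_alt circX). Qed.

Lemma fvec_neq0 s : fvec s != 0 :> fspace X.
Proof.
apply/eqP=> E; have: vset [set s] = 0 by rewrite /vset big_set1.
case/(circ_ker circX) => /setP H.
  by have := H s; rewrite !inE eqxx.
by have := H (sg s); rewrite !inE (negPf (sg_neq sgC s)).
Qed.

Lemma vset_blow_perp U : vset (blow U) \in perp (sg a).
Proof.
by rewrite mem_orthv form_vset !in_blowup (contract0 hatE) (contract2 hatE) addbb.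
Qed.

Lemma mem_red_preim (L : {vspace red_space (sg a)}) v :
  (v \in red_preim L) = (v \in perp (sg a)) && (red_map v \in L).
Proof.
apply/memv_imgP/andP => [[u uL ->]|[vp vL]].
  by rewrite lfunE /= subvsP red_mapE vsvalK memv_preim.
exists (vsproj (perp (sg a)) v); last by rewrite lfunE /= vsprojK.
by rewrite -memv_preim -red_mapE.
Qed.

Lemma red_map_fvec : red_map (fvec (sg a)) = 0.
Proof. by apply/eqP; rewrite red_mapE -memv_ker lker_quotv_pi memv_line. Qed.

Lemma red_map_eq0 v : v \in perp (sg a) -> red_map v = 0 -> v \in <[fvec (sg a)]>%VS.
Proof.
move=> vp /eqP; rewrite red_mapE -memv_ker lker_quotv_pi => /vlineP[k E].
by rewrite -(vsprojK vp) E linearZ /= vsprojK ?fvec_perp // memvZ ?memv_line.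
Qed.

(** Blowing up a singleton index treats the ordinary vertices and the merged vertex uniformly. *)
Lemma red_vecE (i : red_index (sg a)) : red_vec i = red_map (vset (blow [set i])).
Proof.
rewrite red_mapE /red_vec /vset; congr (red_pi _ (vsproj _ _)).
case: i => [t|].
  rewrite (_ : blow _ = [set val t]) ?big_set1 //; apply/setP=> u; rewrite !inE.
  rewrite /contract; case: insubP => [w _ <-|uh].
    by apply/eqP/eqP => [[->] //|/val_inj ->].
  by apply/esym; apply: contraNF uh => /eqP ->; apply: (valP t).
apply: eq_bigl => u; rewrite in_blowup in_set1.
by apply/idP/eqP => [/contract_h //|]; rewrite /contract; case: insubP; rewrite ?negbK.
Qed.

Lemma vset_blow (J : {set red_index (sg a)}) :
  vset (blow J) = \sum_(i in J) vset (blow [set i]).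
Proof.
rewrite /vset (partition_big ctr (mem J)) => [|t]; last by rewrite in_blowup.
apply: eq_bigr => i iJ; apply: eq_bigl => t; rewrite !in_blowup in_set1 andbC.
by case: eqVneq => //= ->.
Qed.

Lemma vset_reduction (J : {set red_index (sg a)}) :
  vset (X := X') J = red_map (vset (blow J)).
Proof. by rewrite vset_blow linear_sum; apply: eq_bigr => i _; apply: red_vecE. Qed.

(** The blown-up members lift the generators of the span of B, and the singleton contributes e_s,
    which spans the kernel of the reduction. *)
Lemma red_preim_Lset (B : {set {set red_index (sg a)}}) :
  red_preim (Lset (X := X') B) = Lset (blowup_basis sg a B).
Proof.
apply/eqP; rewrite eqEsubv; apply/andP; split; last first.
  apply: Lset_sub => K; rewrite !inE mem_red_preim => /orP[/eqP ->|/imsetP[J JB ->]].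
    by rewrite /vset big_set1 fvec_perp red_map_fvec mem0v.
  by rewrite vset_blow_perp -vset_reduction; apply: (memv_Lset (X := X')).
have eL : fvec (sg a) \in Lset (blowup_basis sg a B).
  have -> : fvec (sg a) = vset [set sg a] by rewrite /vset big_set1.
  by apply: memv_Lset; rewrite !inE eqxx.
have subp : (Lset (X := X) [set blow J | J in B] <= perp (sg a))%VS.
  by apply: Lset_sub => K /imsetP[J _ ->]; apply: vset_blow_perp.
have subL : (Lset (X := X) [set blow J | J in B] <= Lset (blowup_basis sg a B))%VS.
  by apply: Lset_sub => K KB; apply: memv_Lset; rewrite inE KB orbT.
apply/subvP=> v; rewrite mem_red_preim => /andP[vp].
have /subvP sub : (Lset (X := X') B <= red_map @: Lset (X := X) [set blow J | J in B])%VS.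
  by apply: Lset_sub => J JB; rewrite vset_reduction memv_img // memv_Lset // imset_f.
case/sub/memv_imgP=> w wL Ev.
(* v and its lift w from the blown-up generators have the same image and both lie in [perp], so they
   differ by a multiple of e_s. *)
have /vlineP[k Ek] : v - w \in <[fvec (sg a)]>%VS.
  apply: red_map_eq0; last by rewrite linearB /= Ev subrr.
  by rewrite memvB // (subvP subp).
by rewrite -[v](subrK w) Ek memvD ?memvZ // (subvP subL).
Qed.

(** The inclusion of [perp] is injective, and the quotient map is onto with a one-dimensional kernel
    because e_s is nonzero. *)
Lemma dim_red_preim (L : {vspace red_space (sg a)}) : \dim (red_preim L) = (\dim L).+1.
Proof.
rewrite /red_preim limg_dim_eq; last first.
  apply/eqP; rewrite -subv0; apply/subvP=> u; rewrite memv_cap memv_ker lfunE /=.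
  by case/andP=> _ /eqP u0; rewrite memv0 -[u]vsvalK u0 linear0.
rewrite -(limg_ker_dim (red_pi (sg a))) lpreimK ?limg_quotv_pi ?subvf //.
rewrite (_ : (_ :&: _)%VS = perp_line (sg a)).
  rewrite dim_vline (_ : _ != 0) //; apply: contra_neq (fvec_neq0 (sg a)) => E.
  by rewrite -(vsprojK fvec_perp) E linear0.
rewrite lker_quotv_pi; apply/capv_idPr/subvP=> u uk.
by rewrite -memv_preim (_ : red_pi _ u = 0) ?mem0v //; apply/eqP; rewrite -memv_ker lker_quotv_pi.
Qed.

Lemma perp_arc (adj : rel (Defs.findex X)) I :
    (forall s t, adj s t = (t == sg s) || (s == sg t)) ->
    I \in I1 adj -> vset I \in perp (sg a) ->
  I = [set sg a] \/ exists J, I = blow J.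
Proof.
move=> adjE I1I; rewrite mem_orthv form_vset F2_natr_eq0 negb_add => /eqP Ea.
exact: (arc_saturated sgC adjE hatE (circ_odd circX)).
Qed.

Lemma circular_reduction : (5 <= #|Defs.findex X|)%N ->
  circular (X := X') (contract_succ sg a (h := hat (sg a))).
Proof.
move=> X5; have sgC' := contract_cyclic sgC hatE X5.
have radl u v : u \in perp_line (sg a) -> sub_form (fform X) (perp (sg a)) u v = 0.
  case/vlineP=> k ->; rewrite linearZl_LR /= sub_formE vsprojK ?fvec_perp //.
  by rewrite circ_sym; have := subvsP v; rewrite mem_orthv => /eqP ->; rewrite mulr0.
have symsub u v : sub_form (fform X) (perp (sg a)) u v = sub_form (fform X) (perp (sg a)) v u.
  by rewrite !sub_formE circ_sym.
have radr u v : u \in perp_line (sg a) -> sub_form (fform X) (perp (sg a)) v u = 0.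
  by move=> uk; rewrite symsub radl.
have formE (i j : red_index (sg a)) : fform X' (fvec (f := X') i) (fvec (f := X') j) =
    fform X (vset (blow [set i])) (vset (blow [set j])).
  transitivity (red_form (sg a) (red_vec i) (red_vec j)); first by [].
  rewrite (red_vecE i) (red_vecE j) 2!red_mapE.
  rewrite /red_form /red_pi. rewrite (quot_formE _ _ radl radr).
  rewrite sub_formE 2?vsprojK //; exact: vset_blow_perp.
have formE_sym (i j : red_index (sg a)) : fform X' (fvec (f := X') i) (fvec (f := X') j) =
    fform X' (fvec (f := X') j) (fvec (f := X') i).
  by rewrite !formE circ_sym.
have altX' x : fform X' x x = 0 by exact: (circ_alt circX).
(* Pairing with an ordinary vertex [val u] only sees its two neighbours, the predecessor w and
   [sg (val u)]. Their contractions are distinct neighbours of [Some u], so exclusive and inclusive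
   disjunction agree. The pairing with [None] then follows by symmetry and alternation. *)
have aux (i : red_index (sg a)) u : fform X' (fvec (f := X') i) (fvec (f := X') (Some u)) =
    ((Some u == contract_succ sg a i) || (i == contract_succ sg a (Some u)))%:R.
  rewrite formE (_ : blow [set Some u] = [set val u]); last first.
    apply/setP=> t; rewrite in_blowup !in_set1 /contract.
    case: insubP => [w _ <-|]; first by apply/eqP/eqP => [[->] //|/val_inj ->].
    by rewrite negbK => th; apply/esym/negbTE; apply: contraTneq th => ->; apply: (valP u).
  rewrite {2}/vset big_set1; have [w Ew] := sg_onto sgC (val u).
  rewrite {1}Ew form_vset -Ew !in_blowup !in_set1; congr (nat_of_bool _)%:R.
  have /and3P[_ wa wb] : [&& sg w != a, w != a & w != sg a].
    by have := valP u; rewrite (in_h hatE) !negb_or Ew !(inj_eq (sg_inj sgC)).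
  have Eu : Some u = contract_succ sg a (ctr w).
    by rewrite -(contract_sg hatE) -?Ew // /contract valK.
  have -> : ctr (sg (val u)) = contract_succ sg a (Some u) by [].
  rewrite {2}Eu (inj_eq (sg_inj sgC')) [i == _]eq_sym.
  case: eqVneq => //= Ei.
  by rewrite Eu -Ei; apply: (sg2_neq sgC').
apply: Circular => //.
- by rewrite (card_contract sgC hatE); have := circ_odd circX; lia.
- move=> i [u|]; first exact: aux.
  case: i => [u|]; first by rewrite formE_sym aux orbC.
  by rewrite altX' orbb eq_sym (negPf (sg_neq sgC' _)).
- rewrite vset_reduction (_ : blow _ = setT) ?(circ_sum circX) ?linear0 //.
  by apply/setP=> t; rewrite !inE.
move=> U; rewrite vset_reduction => /(red_map_eq0 (vset_blow_perp U)).
have Ea : (a \in blow U) = (sg a \in blow U).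
  by rewrite !in_blowup (contract0 hatE) (contract1 hatE).
case/vlineP=> k; case: (F2_eq0_or1 k) => ->.
  rewrite scale0r => /(circ_ker circX)[E|E]; [left | right]; apply: (@blowup_inj _ sg a _ hatE).
    by rewrite E; apply/setP=> t; rewrite !inE.
  by rewrite E; apply/setP=> t; rewrite !inE.
(* The blowup sums to e_s, so toggling [sg a] yields a vanishing sum. The toggled set contains
   exactly one of a and [sg a], so it is neither empty nor full. *)
rewrite scale1r => E.
have [sU|sU] := boolP (sg a \in blow U).
  have : vset (blow U :\ sg a) = 0.
    have := E; rewrite /vset (big_setD1 (sg a)) //= => /eqP.
    by rewrite addrC -subr_eq0 addrK => /eqP.
  case/(circ_ker circX) => /setP E'.
    by have := E' a; rewrite !inE -in_blowup Ea sU eq_sym (sg_neq sgC).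
  by have := E' (sg a); rewrite !inE eqxx.
have : vset (sg a |: blow U) = 0.
  by rewrite /vset big_setU1 //= -/(vset _) E F2_addvv.
case/(circ_ker circX) => /setP E'.
  by have := E' (sg a); rewrite !inE eqxx.
by have := E' a; rewrite !inE -in_blowup Ea (negPf sU) eq_sym (negPf (sg_neq sgC _)).
Qed.

End CircularFamily.

(** * The correspondence between phi and F *)

Definition succ_adj (S : finType) (sg : S -> S) : rel S :=
  fun s t => (t == sg s) || (s == sg t).

Local Notation red_succ sg a := (@contract_succ _ sg a (hat (sg a))).

Lemma phi_set0 (S : finType) (adj : rel S) : set0 \in phi adj.
Proof.
by rewrite inE sub0set /=; apply/andP; split; apply/forall_inP=> I; rewrite inE.
Qed.

Lemma phi_sub (S : finType) (adj : rel S) B : B \in phi adj -> B \subset I1 adj.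
Proof. by rewrite inE => /andP[]. Qed.

(** The induction is on a bound n for the number of vertices, because reduction changes the index
    type. The last two conclusions are what recovers a family from its span. *)
Lemma phi_Fcal n (X : form_family) (sg : Defs.findex X -> Defs.findex X)
    (adj : rel (Defs.findex X)) (B : {set {set Defs.findex X}}) :
    (#|Defs.findex X| < n)%N -> circular sg ->
    (forall s t, adj s t = (t == sg s) || (s == sg t)) -> B \in phi adj ->
  [/\ Fcal X (Lset B), \dim (Lset B) = #|B| &
      forall I, I \in I1 adj -> vset I \in Lset B -> I \in B].
Proof.
elim: n X sg adj B => // n IH X sg adj B; rewrite ltnS => leXn circX adjE Bphi.
have sgC := circ_succ circX.
have vset_neq0 I : I \in I1 adj -> vset I != 0.
  move=> /(I1_rend sgC adjE)[z /setP/(_ z)]; rewrite !inE eqxx => zI.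
  by apply/eqP=> /(circ_ker circX)[] E; rewrite E !inE in zI.
have [->|B0] := eqVneq B set0.
  rewrite Lset0 dimv0 cards0; split=> //; first exact: Fcal0.
  by move=> I I1I; rewrite memv0 (negPf (vset_neq0 I I1I)).
have [s sB] := phi_has_set1 sgC adjE Bphi B0.
have [a Es] := sg_onto sgC s; rewrite {s}Es in sB.
have hE := hatE circX a.
have [B' EB] := phi_blowup_basis sgC adjE hE Bphi sB.
(* This form serves both N >= 5 and N = 3. Oddness and connectedness of J are tested on its blowup,
   since for N = 3 the contracted index set has a single vertex and is not a cycle. *)
suff [FL dL mL] : [/\ Fcal X (Lset B), \dim (Lset (X := reduction (sg a)) B') = #|B'| &
    forall J, blowup J \in I1 adj -> vset (X := reduction (sg a)) J \in Lset (X := reduction (sg a)) B' -> J \in B'].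
  split=> //.
    by rewrite EB -(red_preim_Lset circX) (dim_red_preim circX) dL (card_blowup_basis sgC hE).
  move=> I I1I; rewrite EB -(red_preim_Lset circX) mem_red_preim => /andP[Ip Iv].
  case: (perp_arc circX adjE I1I Ip) => [->|[J EJ]]; first by rewrite !inE eqxx.
  rewrite EJ (mem_blowup_basis sgC hE); apply: mL; first by rewrite -EJ.
  by rewrite vset_reduction -EJ.
have [X5|X3] := leqP 5 #|Defs.findex X|.
  have circX' := circular_reduction circX a X5.
  have X'n : (#|Defs.findex (reduction (sg a))| < n)%N.
    by rewrite (card_contract sgC hE); lia.
  have adjE' s t : succ_adj (red_succ sg a) s t =
    (t == red_succ sg a s) || (s == red_succ sg a t) by [].
  have B'phi : B' \in phi (succ_adj (red_succ sg a)).
    by rewrite -(blowup_basis_phi sgC adjE hE X5 adjE') -EB.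
  have [FB' dB' mB'] := IH (reduction (sg a)) _ _ B' X'n circX' adjE' B'phi.
  split=> //; first by rewrite EB -(red_preim_Lset circX); apply: Fcal5.
  by move=> J; rewrite (blowup_I1 sgC adjE hE X5 adjE'); apply: mB'.
have {}X3 : #|Defs.findex X| = 3%N by have := circ_odd circX; have := card_ge3 sgC; lia.
have notI1 J : blowup J \notin I1 adj := blowup_card3 sgC adjE hE J X3.
have B'0 : B' = set0.
  apply/setP=> J; rewrite inE -(mem_blowup_basis sgC hE); apply: contraNF (notI1 J).
  by apply/subsetP; rewrite -EB; apply: phi_sub.
split.
- rewrite EB B'0 -(red_preim_Lset circX) Lset0; exact: Fcal3.
- by rewrite B'0 Lset0 dimv0 cards0.
by move=> J J1; case/negP: (notI1 J).
Qed.

(** Induction on the derivation; the successor and adjacency are quantified inside, as each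
    reduction brings its own. Each constructor corresponds to the empty family, a singleton family,
    or a lifted family. *)
Lemma Fcal_phi (X : form_family) (L : {vspace fspace X}) : Fcal X L ->
  forall (sg : Defs.findex X -> Defs.findex X) (adj : rel (Defs.findex X)),
    circular sg -> (forall s t, adj s t = (t == sg s) || (s == sg t)) ->
  exists2 B : {set {set Defs.findex X}}, B \in phi adj & L = Lset B.
Proof.
elim=> {X L} [X|X s X3|X s L X5 _ IH] sg adj circX adjE; have sgC := circ_succ circX.
- by exists set0; rewrite ?phi_set0 ?Lset0.
- have [a Es] := sg_onto sgC s; subst s; exists [set [set sg a]].
    exact: set1_phi sgC adjE _.
  by rewrite -(Lset0 (reduction (sg a))) (red_preim_Lset circX) /blowup_basis imset0 setU0.
have [a Es] := sg_onto sgC s; subst s.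
have adjE' s t : succ_adj (red_succ sg a) s t =
    (t == red_succ sg a s) || (s == red_succ sg a t) by [].
have [B' B'phi ->] := IH _ _ (circular_reduction circX a X5) adjE'.
exists (blowup_basis sg a B'); last by rewrite (red_preim_Lset circX).
by rewrite (blowup_basis_phi sgC adjE (hatE circX a) X5 adjE').
Qed.

(** * The quotient by e_S as a circular family *)

Lemma Vbar_circular (S : finType) (adj : rel S) (sg : S -> S)
    (V : vectType 'F_2) (form : {biscalar V}) (e : S -> V) :
    cyclic_succ sg -> odd #|S| ->
    (forall s t, adj s t = (t == sg s) || (s == sg t)) ->
    basis_of fullv (codom e) -> (forall x : V, form x x = 0) ->
    (forall s t : S, s != t -> form (e s) (e t) = (adj s t)%:R) ->
  circular (X := Vbar form e) sg.
Proof.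
move=> sgC oS adjE eB alt formE.
have formE' s t : form (e s) (e t) = ((t == sg s) || (s == sg t))%:R.
  have [<-|st] := eqVneq s t; last by rewrite formE // adjE.
  by rewrite alt orbb eq_sym (negPf (sg_neq sgC s)).
have sym x y : form x y = form y x.
  have := alt (x + y); rewrite linearDl !linearD /= !alt addr0 add0r => /eqP.
  by rewrite addr_eq0 => /eqP ->; case: (F2_eq0_or1 (form y x)) => ->; apply: val_inj.
have sum1 b : \sum_(s : S) (s == b)%:R = 1 :> 'F_2.
  by rewrite (bigD1 b) //= eqxx big1 ?addr0 // => s /negPf->.
(* The vector e_S lies in the radical: each basis vector has exactly two neighbours, contributing 1
   + 1 = 0. The form on the quotient is therefore the induced one. *)
have sum_e z : form (\sum_s e s) z = 0.
  have sub : (<<codom e>> <= orthv form (\sum_s e s))%VS.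
    apply/span_subvP=> v /codomP[t ->]; have [u Eu] := sg_onto sgC t.
    rewrite mem_orthv linear_sumr (eq_bigr (fun s => (s == sg t)%:R + (s == u)%:R)).
      by rewrite big_split /= !sum1.
    move=> s _; rewrite formE' F2_natr_addb {2}Eu (inj_eq (sg_inj sgC)) [u == s]eq_sym.
    case: eqVneq => //= ->; case: eqVneq => // E; have := sg2_neq sgC u.
    by rewrite -Eu E eqxx.
  have := subvP sub z; rewrite (span_basis eB) memvf mem_orthv => /(_ isT)/eqP.
  by rewrite sym.
have radl u z : u \in eS_line e -> form u z = 0.
  by case/vlineP=> k ->; rewrite linearZl_LR /= sum_e mulr0.
have radr u z : u \in eS_line e -> form z u = 0 by move=> uL; rewrite sym radl.
have indep (U : {set S}) : \sum_(s in U) e s = 0 -> U = set0.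
  move=> sU; have /freeP fr : free (codom_tuple e) := basis_free eB.
  have /fr k0 : \sum_(i < #|S|) (enum_val i \in U)%:R *: (codom_tuple e)`_i = 0.
    transitivity (\sum_(s in S) (if s \in U then e s else 0)).
      rewrite [RHS]big_enum_val; apply: eq_bigr => i _; rewrite nth_image.
      by case: (_ \in U); rewrite ?scale1r ?scale0r.
    by rewrite -big_mkcond -[RHS]sU; apply: eq_bigl.
  apply/setP=> s; rewrite inE; have /eqP := k0 (enum_rank s).
  by rewrite F2_natr_eq0 enum_rankK => /negbTE.
have vsetE (U : {set S}) :
    vset (X := Vbar form e) U = quotv_pi (eS_line e) (\sum_(s in U) e s).
  by rewrite linear_sum.
split=> //.
- by move=> x; exact: alt.
- move=> s t; transitivity (form (e s) (e t)); last exact: formE'.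
  exact: quot_formE.
- rewrite vsetE; apply/eqP; rewrite -memv_ker lker_quotv_pi.
  by rewrite (eq_bigl xpredT) ?memv_line // => s; rewrite inE.
move=> U; rewrite vsetE => /eqP; rewrite -memv_ker lker_quotv_pi.
case/vlineP=> k; case: (F2_eq0_or1 k) => ->.
  by rewrite scale0r => /indep; left.
(* If U sums to e_S, the complement of U sums to 0 and is empty by independence. *)
rewrite scale1r (bigID (mem U) predT) /= => /eqP.
rewrite -[X in X == _]addr0 (inj_eq (addrI _)) => /eqP E; right.
apply/eqP; rewrite -subTset -setCS setCT subset0; apply/eqP/indep.
by rewrite [RHS]E; apply: eq_bigl => s; rewrite inE.
Qed.

(** Iterating [next c] from one vertex reaches every other, so a nonempty invariant set is
    everything. *)
Lemma cycle_graph_succ (S : finType) (adj : rel S) : cycle_graph adj ->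
  exists2 sg : S -> S, cyclic_succ sg &
    forall s t, adj s t = (t == sg s) || (s == sg t).
Proof.
case=> c [c3 uc memc adjE]; exists (next c) => //; split.
- exact: (can_inj (prev_next uc)).
- rewrite (leq_trans c3) // -(card_uniqP uc); exact: max_card.
move=> U clU; have [->|/set0Pn[x xU]] := eqVneq U set0; [by left | right].
apply/setP=> y; rewrite inE; have := memc y.
rewrite -(fconnect_cycle (cycle_next uc) (memc x)) => /iter_findex <-.
by elim: (fingraph.findex _ _ _) => //= k; apply: clU.
Qed.

Theorem mainTheorem2 (N : nat) (S : finType) (adj : rel S)
    (V : vectType 'F_2) (form : {biscalar V}) (e : S -> V)
    (N_ge3 : (3 <= N)%N) (N_odd : odd N)
    (adj_cycle : cycle_graph adj) (card_S : #|S| = N)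
    (e_basis : basis_of fullv (codom e))
    (form_alt : forall x : V, form x x = 0)
    (form_e : forall s t : S, s != t -> form (e s) (e t) = (adj s t)%:R)
    (B : {set {set S}}) (B_sub : B \subset I1 adj) :
  B \in phi adj <-> Fcal (Vbar form e) (LB e B).
Proof.
have [sg sgC adjE] := cycle_graph_succ adj_cycle.
have circX : circular (X := Vbar form e) sg.
  by apply: (Vbar_circular sgC _ adjE) => //; rewrite card_S.
split=> [Bphi|FB]; first by have [] := phi_Fcal (ltnSn _) circX adjE Bphi.
have [C Cphi EL] := Fcal_phi FB circX adjE.
have [_ dC mC] := phi_Fcal (ltnSn _) circX adjE Cphi.
have BC : B \subset C.
  apply/subsetP=> I IB; apply: mC; first exact: (subsetP B_sub).
  by rewrite -EL; apply: (memv_Lset (X := Vbar form e)).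
have /eqP -> // : B == C.
(* The size of C is the dimension of its span, which equals L_B and is generated by [#|B|]
   vectors. *)
rewrite eqEcard BC -dC -EL /= (leq_trans (dim_span _)) //.
by rewrite size_image.
Qed.
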